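(* Let $f$ be an operator convex function on an interval $I\subseteq\mathbb{R}$ and $A,B\in\mathcal{SA}_I(H)$, where $H$ is a Hilbert space, while $p:[0,1]\to\mathbb{R}$ is symmetric, i.e. $p(1-t)=p(t)$ for all $t\in[0,1]$, and non-decreasing on $[0,1/2]$. (i) If $p$ is differentiable on $(0,1)$, then in the operator order \[ 0\le \int_0^1 p(t)\,dt\int_0^1 f\big(tA+(1-t)B\big)\,dt-\int_0^1 p(t) f\big(tA+(1-t)B\big)\,dt \le \frac18\|p'\|_\infty\left[\frac{f(A)+f(B)}{2}-f\left(\frac{A+B}{2}\right)\right]. \] (ii) If $f\in\mathcal{G}([A,B])$, then in the operator order \[ 0\le \int_0^1 p(t)\,dt\int_0^1 f\big(tA+(1-t)B\big)\,dt-\int_0^1 p(t) f\big(tA+(1-t)B\big)\,dt \] \[ \le \frac1{16}\left[p\left(\tfrac12\right)-p(0)\right]\left[\nabla f_B(B-A)-\nabla f_A(B-A)\right]. \]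
   Context: $\mathcal{SA}_I(H)$ denotes the class of all selfadjoint operators on $H$ with spectra in $I$, and $\mathcal{B}(H)$ the bounded linear operators on $H$. For a continuous function $f$ on $I$ and $T\in\mathcal{SA}_I(H)$, $f(T)$ is defined by the continuous functional calculus, and the corresponding function of operators $\mathcal{SA}_I(H)\to\mathcal{B}(H)$ is denoted by the same letter $f$. The operator order is: $S\le T$ iff $\langle Sx,x\rangle\le\langle Tx,x\rangle$ for all $x\in H$. A real valued continuous function $f$ on $I$ is operator convex on $I$ if $f((1-\lambda)S+\lambda T)\le(1-\lambda)f(S)+\lambda f(T)$ in the operator order for all $\lambda\in[0,1]$ and all selfadjoint operators $S,T$ on a Hilbert space $H$ whose spectra are contained in $I$. $\|p'\|_\infty$ denotes the supremum norm $\sup_{t\in(0,1)}|p'(t)|$. For two distinct operators $A,B\in\mathcal{SA}_I(H)$, the segment is $[A,B]:=\{(1-t)A+tB : t\in[0,1]\}\subset\mathcal{SA}_I(H)$. A continuous function $g:\mathcal{SA}_I(H)\to\mathcal{B}(H)$ is Gâteaux differentiable in $T\in\mathcal{SA}_I(H)$ along the direction $S\in\mathcal{B}(H)$ if the limit \[ \nabla g_T(S):=\lim_{s\to0}\frac{g(T+sS)-g(T)}{s}\in\mathcal{B}(H) \] exists in the strong topology of $\mathcal{B}(H)$. If this limit exists for all $S\in\mathcal{B}(H)$, then $g$ is said to be Gâteaux differentiable in $T$, written $g\in\mathcal{G}(T)$. If this is true for every $T$ in a set $\mathcal{S}\subset\mathcal{SA}_I(H)$, one writes $g\in\mathcal{G}(\mathcal{S})$;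 thus $f\in\mathcal{G}([A,B])$ means that $f$ is Gâteaux differentiable in every $T\in[A,B]$. *)

(* Defs.v *)
From HB Require Import structures.
From mathcomp Require Import all_boot all_order all_algebra.
From mathcomp Require Import sesquilinear complex.
From mathcomp Require Import all_classical all_reals all_analysis.

Set Implicit Arguments.
Unset Strict Implicit.
Unset Printing Implicit Defensive.

Import Order.TTheory GRing.Theory Num.Theory.
Import numFieldNormedType.Exports.

Local Open Scope classical_set_scope.
Local Open Scope ring_scope.
Local Open Scope complex_scope.

(* Complex Hilbert spaces; the inner product is linear in its first argument. *)
HB.mixin Record CompleteNormedModule_isHilbert (R : realType) H
    of CompleteNormedModule R[i] H := {
  dotp : {dot H for Num.conj};
  sqr_normE : forall x : H, `|x| ^+ 2 = dotp x x }.

#[short(type="hilbertType")]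
HB.structure Definition Hilbert (R : realType) :=
  {H of CompleteNormedModule R[i] H & CompleteNormedModule_isHilbert R H}.

Section Operators.
Context {R : realType} {H : hilbertType R}.
Implicit Types (S T X L : H -> H) (f : R -> R) (I : interval R).

(* Operators are plain functions, with the pointwise vector space structure. *)
Definition bounded_op T : Prop :=
  linear T /\ exists M : R, forall x, `|T x| <= M%:C * `|x|.

Definition opnorm T : R :=
  sup [set complex.Re `|T x| | x in [set x : H | `|x| <= 1]].

Definition selfadjoint T : Prop :=
  bounded_op T /\ forall x y, dotp (T x) y = dotp x (T y).

(* In the order of R[i], u <= v means that v - u is real and nonnegative. *)
Definition op_le S T : Prop := forall x, dotp (S x) x <= dotp (T x) x.

Definition spectrum T : set R[i] :=
  [set z | ~ exists S, [/\ bounded_op S,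
     S \o (T - z *: idfun) = idfun & (T - z *: idfun) \o S = idfun]].

Definition SA I : set (H -> H) :=
  [set T | selfadjoint T /\ spectrum T `<=` [set t%:C | t in [set` I]]].

Definition op_poly (q : {poly R}) T : H -> H :=
  \sum_(k < size q) (q`_k)%:C *: iter k T.

(* f(T) is the norm limit of q_n(T) for real polynomials q_n converging to f
   uniformly on the spectrum of T, which is real when T is selfadjoint. *)
Definition is_cfc f T X : Prop :=
  bounded_op X /\ exists q : nat -> {poly R},
    {uniform [set t : R | spectrum T t%:C],
      (fun n => horner (q n)) @ \oo --> f} /\
    opnorm (op_poly (q n) T - X) @[n --> \oo] --> 0.

Definition cfc f T : H -> H := get [set X | is_cfc f T X].

(* Riemann integral over [0, 1] in the operator norm: the partition is
   0 < s_0 < ... < s_(m-1) = 1 and xi k is the tag of the k-th subinterval. *)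
Definition is_op_integral (F : R -> H -> H) X : Prop :=
  bounded_op X /\
  forall e : R, 0 < e -> exists2 d : R, 0 < d &
    forall (s : seq R) (xi : nat -> R), itv_partition 0 1 s ->
      (forall k, (k < size s)%N ->
        nth 0 (0 :: s) k <= xi k <= nth 0 s k /\
        nth 0 s k - nth 0 (0 :: s) k < d) ->
      opnorm (\sum_(k < size s)
        (nth 0 s k - nth 0 (0 :: s) k)%:C *: F (xi k) - X) < e.

Definition op_integral (F : R -> H -> H) : H -> H :=
  get [set X | is_op_integral F X].

(* The limit for s -> 0 runs over the real s <> 0 at which T + s S belongs to
   the domain SA I of g; it may be one-sided, and it imposes nothing on the
   directions along which T is isolated in SA I. *)
Definition is_gateaux I (g : (H -> H) -> (H -> H)) T S L : Prop :=
  bounded_op L /\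
  forall x, (s^-1)%:C *: (g (T + s%:C *: S) x - g T x)
    @[s --> within [set s : R | SA I (T + s%:C *: S)] (0 : R)^'] --> L x.

Definition nabla I (g : (H -> H) -> (H -> H)) T S : H -> H :=
  get [set L | is_gateaux I g T S L].

Definition gateaux_at I (g : (H -> H) -> (H -> H)) T : Prop :=
  forall S, bounded_op S -> exists L, is_gateaux I g T S L.

Definition gateaux_on I (g : (H -> H) -> (H -> H)) (D : set (H -> H)) : Prop :=
  forall T, D T -> gateaux_at I g T.

Definition segment (A B : H -> H) : set (H -> H) :=
  [set (1 - t)%:C *: A + t%:C *: B | t in `[0, 1]].

End Operators.

Definition operator_convex (R : realType) (I : interval R) (f : R -> R) : Prop :=
  {within [set` I], continuous f} /\
  forall (H : hilbertType R) (S T : H -> H) (l : R), SA I S -> SA I T ->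
    0 <= l <= 1 ->
    op_le (cfc f ((1 - l)%:C *: S + l%:C *: T))
          ((1 - l)%:C *: cfc f S + l%:C *: cfc f T).

(* Real-valued supremum norm on ]0, 1[, meaningless when g is unbounded. *)
Definition supnorm01 (R : realType) (g : R -> R) : R :=
  sup [set `|g t| | t in `]0, 1[ ].

(* Main.v *)
(* Everything is reduced to scalars through the real forms phi_x(t) = Re <F(t) x, x> with
   F(t) = f(tA + (1 - t)B), which are convex in t by operator convexity of f.

   For a real polynomial q and a selfadjoint T, the maximum of the form of q(T) belongs to
   the spectrum of q(T), and factoring q - max over the complex numbers shows that it is a
   value of q on the spectrum of T. Hence |q(T)| is at most the maximum of |q| on the
   spectrum, so with Weierstrass approximation f(T) exists, and F is continuous in norm.
   As p is of bounded variation, the Riemann sums of p F converge in norm.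

   It remains to bound M(p) M(phi) - M(p phi) for the average M over the midpoints of a
   uniform subdivision of [0, 1]. There phi may be replaced by its symmetrization psi, which
   is non-increasing on [0, 1/2] while p is non-decreasing; this gives the lower bound.
   Since p - p(1/4) and psi - psi(1/4) are, up to Lipschitz constants, at most
   w(t) = ||t - 1/2| - 1/4|, whose average is 1/8, writing the covariance as
   M((M(psi) - psi) (p - p(1/4))) or as M((M(p) - p) (psi - psi(1/4))) gives (i) and (ii). *)
Require Import Defs.
From HB Require Import structures.
From mathcomp Require Import all_boot all_order all_algebra.
From mathcomp Require Import sesquilinear complex ring lra.
From mathcomp Require Import all_classical all_reals all_analysis measurable_realfun.
Import Order.TTheory GRing.Theory Num.Theory.
Import numFieldNormedType.Exports.
Local Open Scope classical_set_scope.
Local Open Scope ring_scope.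
Local Open Scope complex_scope.

Set Implicit Arguments.
Unset Strict Implicit.
Unset Printing Implicit Defensive.

(** * The real inner product space underlying a complex Hilbert space *)

Section RealForm.
Context {R : realType} {H : hilbertType R}.
Implicit Types (x y z : H) (a b : R).

(** The weight [p] may be discontinuous, in (i) still at 0 and 1, so Riemann sums cannot be
    controlled by continuity of the integrand; monotonicity on each half of [0, 1] replaces it.

    [cfc], [op_integral] and [nabla] are choices made by [get]: nothing is known about them until an
    object with the required property has been constructed.

    The interval [I] need not be compact. A single compact subinterval containing the spectra of all
    operators of the segment is extracted from the forms of [A] and [B].

    The inequalities are proved for finite averages without any error term. The lower bound holds
    for every number of midpoints, because t -> 1 - t permutes them; the upper bounds hold when that
    number is a multiple of 4, because then the average of w is exactly 1/8. One passage to the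
    limit, for a fixed vector, finishes the proof.

    The constant 1/16 is 1/8 times 1/2: the slope of psi at 0 is the mean of the inward slopes of
    phi at the two ends.

    The zero space is set apart, since all spectra are empty there and no maximum of a form can be a
    spectral point. *)

Definition nrm (x : H) : R := complex.Re `|x|.
Definition rdot (x y : H) : R := complex.Re (dotp x y).

Lemma dotpC x y : dotp y x = (dotp x y)^*.
Proof. by rewrite hermC expr0 mul1r. Qed.

Lemma normE x : `|x| = (nrm x)%:C.
Proof. by rewrite /nrm RRe_real// normr_real. Qed.

Lemma nrm_ge0 x : 0 <= nrm x.
Proof. by rewrite -ler0c -normE. Qed.

Lemma nrm0 : nrm 0 = 0.
Proof. by rewrite /nrm normr0. Qed.

Lemma nrm_eq0 x : nrm x = 0 -> x = 0.
Proof. by move=> x0; apply/eqP; rewrite -normr_eq0 normE x0. Qed.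

Lemma nrmD x y : nrm (x + y) <= nrm x + nrm y.
Proof. by rewrite -lecR rmorphD/= -!normE; exact: ler_normD. Qed.

Lemma nrmN x : nrm (- x) = nrm x.
Proof. by rewrite /nrm normrN. Qed.

Lemma nrmB x y : nrm (x - y) <= nrm x + nrm y.
Proof. by rewrite (le_trans (nrmD _ _))// nrmN. Qed.

Lemma nrmBC x y : nrm (x - y) = nrm (y - x).
Proof. by rewrite -nrmN opprB. Qed.

Lemma nrmBD z x y : nrm (x - y) <= nrm (x - z) + nrm (z - y).
Proof. by rewrite -[x - y](subrKA z) nrmD. Qed.

Lemma nrmZc (c : R[i]) x : nrm (c *: x) = complex.Re `|c| * nrm x.
Proof.
by rewrite /nrm normrZ [`|c|]normc_def/= normE/= mulr0 subr0.
Qed.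

Lemma nrmZ a x : nrm (a%:C *: x) = `|a| * nrm x.
Proof. by rewrite nrmZc normc_def/= expr0n/= addr0 sqrtr_sqr. Qed.

Lemma rdotC x y : rdot x y = rdot y x.
Proof. by rewrite /rdot (dotpC x y); case: (dotp x y). Qed.

Lemma rdotDl x y z : rdot (x + y) z = rdot x z + rdot y z.
Proof. by rewrite /rdot linearDl raddfD. Qed.

Lemma rdotNl x y : rdot (- x) y = - rdot x y.
Proof. by rewrite /rdot linearNl raddfN. Qed.

Lemma rdotBl x y z : rdot (x - y) z = rdot x z - rdot y z.
Proof. by rewrite rdotDl rdotNl. Qed.

Lemma rdotZl a x y : rdot (a%:C *: x) y = a * rdot x y.
Proof. by rewrite /rdot linearZl_LR/=; case: (dotp x y) => u v /=; rewrite mul0r subr0. Qed.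

Lemma rdotZil x y : rdot ('i *: x) y = - complex.Im (dotp x y).
Proof.
by rewrite /rdot linearZl_LR/=; case: (dotp x y) => u v /=; rewrite mul0r mul1r sub0r.
Qed.

Lemma rdot0l x : rdot 0 x = 0.
Proof. by rewrite /rdot linear0l. Qed.

Lemma rdotDr x y z : rdot z (x + y) = rdot z x + rdot z y.
Proof. by rewrite !(rdotC z) rdotDl. Qed.

Lemma rdotNr x y : rdot y (- x) = - rdot y x.
Proof. by rewrite !(rdotC y) rdotNl. Qed.

Lemma rdotBr x y z : rdot z (x - y) = rdot z x - rdot z y.
Proof. by rewrite !(rdotC z) rdotBl. Qed.

Lemma rdotZr a x y : rdot y (a%:C *: x) = a * rdot y x.
Proof. by rewrite !(rdotC y) rdotZl. Qed.

Lemma rdotZir x y : rdot x ('i *: y) = complex.Im (dotp x y).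
Proof. by rewrite rdotC rdotZil dotpC; case: (dotp x y) => u v /=; rewrite opprK. Qed.

Lemma rdotxx x : rdot x x = nrm x ^+ 2.
Proof. by rewrite /rdot -sqr_normE normE -rmorphXn. Qed.

Lemma dotp_re x : dotp x x = (nrm x ^+ 2)%:C.
Proof. by rewrite -sqr_normE normE -rmorphXn. Qed.

Lemma rdot_suml n (F : 'I_n -> H) y : rdot (\sum_(i < n) F i) y = \sum_(i < n) rdot (F i) y.
Proof. by elim/big_ind2 : _ => [|u a v b <- <-|]; rewrite ?rdot0l ?rdotDl. Qed.

Lemma nrmD_sqr x y : nrm (x + y) ^+ 2 = nrm x ^+ 2 + 2 * rdot x y + nrm y ^+ 2.
Proof. by rewrite -!rdotxx !(rdotDl, rdotDr) (rdotC y x); ring. Qed.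

Lemma nrmB_sqr x y : nrm (x - y) ^+ 2 = nrm x ^+ 2 - 2 * rdot x y + nrm y ^+ 2.
Proof. by rewrite nrmD_sqr rdotNr nrmN; ring. Qed.

(** Semidefinite forms are allowed because the form of m - T in [form_max_in_spectrum] is one,
    besides [rdot] itself. *)
Lemma form_cauchy_schwarz (q : H -> H -> R) :
  (forall x, 0 <= q x x) -> (forall x y, q x y = q y x) ->
  (forall x y z, q (x + y) z = q x z + q y z) ->
  (forall a x y, q (a%:C *: x) y = a * q x y) ->
  forall x y, q x y ^+ 2 <= q x x * q y y.
Proof.
move=> q0 qC qD qZ x y.
have E a b : q (a%:C *: x + b%:C *: y) (a%:C *: x + b%:C *: y) =
    a ^+ 2 * q x x + 2 * a * b * q x y + b ^+ 2 * q y y.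
  by rewrite qD !qZ !(qC _ (_ + _)) !qD !qZ (qC y x); ring.
have [qy0|qy0] := eqVneq (q y y) 0.
  have [->|qxy] := eqVneq (q x y) 0; first by rewrite expr0n/= qy0 mulr0.
  (* When [q y y = 0] the form is affine along [y]; this coefficient makes its value -1. *)
  have := q0 (1%:C *: x + (- (1 + q x x) / (2 * q x y))%:C *: y).
  rewrite E qy0 mulr0 addr0 expr1n mulr1 mul1r.
  have -> : 2 * (- (1 + q x x) / (2 * q x y)) * q x y = - (1 + q x x) by field.
  by lra.
have qyp : 0 < q y y by rewrite lt_neqAle eq_sym qy0 q0.
(* Up to the factor [q y y], this vector is the part of [x] orthogonal to [y]. *)
have := q0 ((q y y)%:C *: x + (- q x y)%:C *: y); rewrite E.
have -> : q y y ^+ 2 * q x x + 2 * q y y * - q x y * q x y + (- q x y) ^+ 2 * q y y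
   = q y y * (q x x * q y y - q x y ^+ 2) by ring.
by rewrite pmulr_rge0// subr_ge0.
Qed.

Lemma rdot_le x y : rdot x y <= nrm x * nrm y.
Proof.
apply: le_trans (ler_norm _) _.
rewrite -(@ler_pXn2r _ 2)// ?nnegrE ?mulr_ge0 ?nrm_ge0//.
rewrite real_normK ?num_real// exprMn -!rdotxx.
apply: form_cauchy_schwarz => [z|||]; [|exact: rdotC|exact: rdotDl|exact: rdotZl].
by rewrite rdotxx exprn_ge0// nrm_ge0.
Qed.

Lemma normr_rdot_le x y : `|rdot x y| <= nrm x * nrm y.
Proof.
rewrite ler_norml rdot_le andbT lerNl -rdotNl -(nrmN x); exact: rdot_le.
Qed.

Lemma nrm_le_rdot x c : 0 <= c -> (forall y, rdot x y <= c * nrm y) -> nrm x <= c.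
Proof.
move=> c0 h; have := h x; rewrite rdotxx expr2.
have [->//|x0] := eqVneq (nrm x) 0.
by rewrite ler_pM2r// lt_neqAle eq_sym x0 nrm_ge0.
Qed.

(** The norm takes values in R[i], where 0 < e forces e to be real, so real radii suffice. *)
Lemma cvgHP (T : Type) (F : set_system T) {FF : Filter F} (u : T -> H) (l : H) :
  (u @ F --> l) <-> (forall e, 0 < e -> \forall t \near F, nrm (u t - l) < e).
Proof.
split=> [/cvgrPdist_lt h e e0|h].
  have e0' : (0 : R[i]) < e%:C by rewrite ltcR.
  apply: filterS (h _ e0') => t; rewrite normE ltcR nrmBC//.
apply/cvgrPdist_lt => e; rewrite ltcE /= => /andP[/eqP e1 e2].
apply: filterS (h _ e2) => t; rewrite normE nrmBC => ut.
by rewrite ltcE/= e1 eqxx.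
Qed.

Lemma cauchyHP (u : nat -> H) :
  (forall e, 0 < e -> exists N, forall m n, (N <= m)%N -> (N <= n)%N ->
    nrm (u m - u n) <= e) -> exists l : H, u @ \oo --> l.
Proof.
move=> h; suff: cvg (u @ \oo) by move=> ?; exists (lim (u @ \oo)).
apply/cauchy_cvgP/cauchy_exP => e; rewrite ltcE/= => /andP[/eqP e1 e2].
have [N hN] := h (complex.Re e / 2) ltac:(by rewrite divr_gt0).
exists (u N); exists N => // n /= Nn.
rewrite -ball_normE /ball_/= normE ltcE/= e1 eqxx/=.
by apply: le_lt_trans (hN _ _ (leqnn N) Nn) _; rewrite ltr_pdivrMr// ltr_pMr// ltr1n.
Qed.

End RealForm.

(** * Bounded operators *)

Section BoundedOperators.
Context {R : realType} {H : hilbertType R}.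
Implicit Types (x y z : H) (a b c e : R) (S T X : H -> H).

(** Bounds compose and add without the side conditions attached to the supremum in [opnorm]. *)
Definition opb T c := forall x, nrm (T x) <= c * nrm x.

Lemma linD T : linear T -> {morph T : x y / x + y}.
Proof. by move=> lT x y; have := lT 1 x y; rewrite !scale1r. Qed.

Lemma lin0 T : linear T -> T 0 = 0.
Proof. by move=> lT; apply: (addrI (T 0)); rewrite -linD// !addr0. Qed.

Lemma linZ T : linear T -> forall (k : R[i]) x, T (k *: x) = k *: T x.
Proof. by move=> lT k x; have := lT k x 0; rewrite !addr0 lin0// addr0. Qed.

Lemma linN T : linear T -> {morph T : x / - x}.
Proof. by move=> lT x; rewrite -scaleN1r linZ// scaleN1r. Qed.

Lemma linB T : linear T -> {morph T : x y / x - y}.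
Proof. by move=> lT x y; rewrite linD// linN. Qed.

Lemma bounded_opP T : bounded_op T <-> linear T /\ exists2 c, 0 <= c & opb T c.
Proof.
split=> -[lT [c]] => [hc|c0 hc]; split=> //.
  exists (Num.max c 0); first by rewrite le_max lexx orbT.
  move=> x; have := hc x; rewrite !normE -rmorphM lecR => /le_trans; apply.
  by rewrite ler_wpM2r ?nrm_ge0// le_max lexx.
by exists c => x; rewrite !normE -rmorphM lecR.
Qed.

Lemma bopI T c : linear T -> 0 <= c -> opb T c -> bounded_op T.
Proof. by move=> lT c0 hc; apply/bounded_opP; split=> //; exists c. Qed.

Lemma bop0 : bounded_op (0 : H -> H).
Proof.
apply: (@bopI _ 0) => // [k x y|x]; first by rewrite scaler0 addr0.
by rewrite mul0r nrm0.
Qed.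

Lemma bop_id : bounded_op (idfun : H -> H).
Proof. by apply: (@bopI _ 1) => // x; rewrite mul1r. Qed.

Lemma bopD S T : bounded_op S -> bounded_op T -> bounded_op (S + T).
Proof.
move=> /bounded_opP[lS [c c0 hc]] /bounded_opP[lT [d d0 hd]].
apply: (@bopI _ (c + d)) => [k x y||x]; last 2 first.
- exact: addr_ge0.
- by rewrite (le_trans (nrmD _ _))// mulrDl lerD.
- change (S (k *: x + y) + T (k *: x + y) = k *: (S x + T x) + (S y + T y)).
  by rewrite lS lT scalerDr addrACA.
Qed.

Lemma bopZ (k : R[i]) T : bounded_op T -> bounded_op (k *: T).
Proof.
move=> /bounded_opP[lT [d d0 hd]].
apply: (@bopI _ (complex.Re `|k| * d)) => [j x y||x].
- change (k *: T (j *: x + y) = j *: (k *: T x) + k *: T y).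
  by rewrite lT scalerDr !scalerA mulrC.
- by rewrite mulr_ge0// normc_def/= sqrtr_ge0.
- change (nrm (k *: T x) <= complex.Re `|k| * d * nrm x).
  by rewrite nrmZc -mulrA ler_wpM2l// normc_def/= sqrtr_ge0.
Qed.

Lemma bopN T : bounded_op T -> bounded_op (- T).
Proof. by move=> /(bopZ (-1)); rewrite scaleN1r. Qed.

Lemma bopB S T : bounded_op S -> bounded_op T -> bounded_op (S - T).
Proof. by move=> bS /bopN; exact: bopD. Qed.

Lemma bop_comp S T : bounded_op S -> bounded_op T -> bounded_op (S \o T).
Proof.
move=> /bounded_opP[lS [c c0 hc]] /bounded_opP[lT [d d0 hd]].
apply: (@bopI _ (c * d)) => [k x y||x] /=; first by rewrite lT lS.
- by rewrite mulr_ge0.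
- by rewrite (le_trans (hc _))// -mulrA ler_wpM2l.
Qed.

Lemma bop_sum n (F : 'I_n -> H -> H) : (forall i, bounded_op (F i)) ->
  bounded_op (\sum_(i < n) F i).
Proof. by move=> bF; elim/big_ind : _ => //; [exact: bop0|exact: bopD]. Qed.

Lemma opb_le T c d : c <= d -> opb T c -> opb T d.
Proof. by move=> cd h x; rewrite (le_trans (h x))// ler_wpM2r ?nrm_ge0. Qed.

Lemma opb_opnorm T : bounded_op T -> opb T (opnorm T).
Proof.
move=> /bounded_opP[lT [d d0 hd]] x.
have [x0|x0] := eqVneq (nrm x) 0.
  by rewrite (nrm_eq0 x0) lin0// nrm0 mulr0.
have xp : 0 < nrm x by rewrite lt_neqAle eq_sym x0 nrm_ge0.
rewrite -ler_pdivrMr// mulrC.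
rewrite -[X in X * _]ger0_norm ?invr_ge0 ?nrm_ge0// -nrmZ -linZ//.
apply: ub_le_sup.
  exists d => _ [y /= y1 <-]; apply: le_trans (hd y) _.
  rewrite ler_piMr//; move: y1; rewrite normE -[1]/(1%:C) lecR//.
exists ((nrm x)^-1%:C *: x) => //=.
rewrite normE nrmZ ger0_norm ?invr_ge0 ?nrm_ge0// mulVf//.
Qed.

Lemma opnorm_le T c : 0 <= c -> opb T c -> opnorm T <= c.
Proof.
move=> c0 hc; apply: sup_le_ub.
  by exists (complex.Re `|T 0|), 0 => //=; rewrite normr0.
move=> _ [y /= y1 <-]; apply: le_trans (hc y) _.
by rewrite ler_piMr//; move: y1; rewrite normE -[1]/(1%:C) lecR.
Qed.

Lemma opnorm_ge0 T : bounded_op T -> 0 <= opnorm T.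
Proof.
move=> /bounded_opP[lT [d d0 hd]]; apply: ub_le_sup.
  exists d => _ [y /= y1 <-]; apply: le_trans (hd y) _.
  by rewrite ler_piMr//; move: y1; rewrite normE -[1]/(1%:C) lecR.
by exists 0; rewrite /= ?normr0// lin0// normr0.
Qed.

Lemma opnorm_cvg0P (T : nat -> H -> H) : (forall n, bounded_op (T n)) ->
  (opnorm (T n) @[n --> \oo] --> (0 : R)) <->
  (forall e, 0 < e -> exists N, forall n, (N <= n)%N -> opb (T n) e).
Proof.
move=> bT; split=> [/cvgr0Pnorm_lt h e /h[N _ hN]|h].
  exists N => n Nn; have /= := hN _ Nn; rewrite ger0_norm ?opnorm_ge0// => /ltW.
  by move=> ?; apply: opb_le (opb_opnorm _).
apply/cvgr0Pnorm_le => e e0; have [N hN] := h _ e0; exists N => // n Nn /=.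
by rewrite ger0_norm ?opnorm_ge0// opnorm_le ?(ltW e0)//; exact: hN.
Qed.

Definition symop T := forall x y, rdot (T x) y = rdot x (T y).

(** Testing the real identity against 'i *: y recovers the imaginary parts of the inner products. *)
Lemma selfadjointP T : selfadjoint T <-> bounded_op T /\ symop T.
Proof.
split=> -[bT sT]; split=> // x y; first by rewrite /rdot sT.
have := sT x y; have := sT x ('i *: y).
rewrite linZ; last by case: bT.
rewrite !rdotZir /rdot; case: (dotp (T x) y) => u v; case: (dotp x (T y)) => w t.
by move=> /= -> ->.
Qed.

Lemma selfadjoint_bop T : selfadjoint T -> bounded_op T.
Proof. by case. Qed.

Lemma selfadjoint_symop T : selfadjoint T -> symop T.
Proof. by move=> /selfadjointP[]. Qed.

Lemma selfadjointD S T : selfadjoint S -> selfadjoint T -> selfadjoint (S + T).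
Proof.
move=> /selfadjointP[bS sS] /selfadjointP[bT sT]; apply/selfadjointP; split.
  exact: bopD.
move=> x y; change (rdot (S x + T x) y = rdot x (S y + T y)).
by rewrite rdotDl rdotDr sS sT.
Qed.

Lemma selfadjointZ a T : selfadjoint T -> selfadjoint (a%:C *: T).
Proof.
move=> /selfadjointP[bT sT]; apply/selfadjointP; split; first exact: bopZ.
move=> x y; change (rdot (a%:C *: T x) y = rdot x (a%:C *: T y)).
by rewrite rdotZl rdotZr sT.
Qed.

Lemma selfadjointB S T : selfadjoint S -> selfadjoint T -> selfadjoint (S - T).
Proof.
move=> sS /(selfadjointZ (-1)); rewrite rmorphN scaleN1r; exact: selfadjointD.
Qed.

Lemma selfadjoint0 : selfadjoint (0 : H -> H).
Proof.
apply/selfadjointP; split; first exact: bop0.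
by move=> x y; change (rdot 0 y = rdot x 0); rewrite (rdotC x) !rdot0l.
Qed.

Lemma selfadjoint_id : selfadjoint (idfun : H -> H).
Proof. by apply/selfadjointP; split => //; exact: bop_id. Qed.

Lemma selfadjoint_sum n (F : 'I_n -> H -> H) : (forall i, selfadjoint (F i)) ->
  selfadjoint (\sum_(i < n) F i).
Proof.
by move=> bF; elim/big_ind : _ => //; [exact: selfadjoint0|exact: selfadjointD].
Qed.

(** The order of R[i] also demands equal imaginary parts; for selfadjoint operators these vanish. *)
Lemma op_leP S T : selfadjoint S -> selfadjoint T ->
  op_le S T <-> forall x, rdot (S x) x <= rdot (T x) x.
Proof.
have im T' x : selfadjoint T' -> complex.Im (dotp (T' x) x) = 0.
  move=> sT; have := dotpC (T' x) x; rewrite -sT.2.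
  by case: (dotp (T' x) x) => u v [] /=; lra.
by move=> sS sT; split=> h x; have := h x; rewrite lecE !im// eqxx.
Qed.

(* Polarization at x +/- d^-1 T x. *)
Lemma symop_opb T c : linear T -> symop T -> 0 <= c ->
  (forall x, `|rdot (T x) x| <= c * nrm x ^+ 2) -> opb T c.
Proof.
move=> lT sT c0 h x.
(* Since [c] may be 0, it is enlarged to a positive [d] that can be inverted. *)
suff hd d : 0 < d -> c <= d -> nrm (T x) <= d * nrm x.
  apply/ler_addgt0Pr => e e0.
  have : nrm (T x) <= (c + e / (1 + nrm x)) * nrm x.
    apply: hd; first by rewrite ltr_wpDl// divr_gt0// ltr_pwDl// nrm_ge0.
    by rewrite lerDl ltW// divr_gt0// ltr_pwDl// nrm_ge0.
  move=> /le_trans; apply; rewrite mulrDl lerD2l mulrAC ler_pdivrMr.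
    by rewrite ler_wpM2l ?(ltW e0)// lerDr ler01.
  by rewrite ltr_pwDl// nrm_ge0.
move=> d0 cd; set y := d^-1%:C *: T x.
have := h (x + y); have := h (x - y).
rewrite linB// linD// !ler_norml => /andP[h1 _] /andP[_ h2].
have : 4 * rdot (T x) y <= 2 * c * (nrm x ^+ 2 + nrm y ^+ 2).
  have <- : c * nrm (x - y) ^+ 2 + c * nrm (x + y) ^+ 2 = 2 * c * (nrm x ^+ 2 + nrm y ^+ 2).
    by rewrite nrmB_sqr nrmD_sqr; ring.
  have E : rdot (T x + T y) (x + y) - rdot (T x - T y) (x - y) = 4 * rdot (T x) y.
    rewrite !(rdotDl, rdotDr, rdotNl, rdotNr) (rdotC (T y) x) -sT; ring.
  by rewrite -E; lra.
rewrite /y rdotZr rdotxx nrmZ ger0_norm ?invr_ge0 ?(ltW d0)// => h3.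
rewrite -(@ler_pXn2r _ 2)// ?nnegrE ?mulr_ge0 ?nrm_ge0 ?(ltW d0)//.
have : 4 * (d^-1 * nrm (T x) ^+ 2) <= 2 * d * (nrm x ^+ 2 + (d^-1 * nrm (T x)) ^+ 2).
  apply: le_trans h3 _; rewrite ler_wpM2r ?addr_ge0 ?sqr_ge0//.
  by rewrite ler_pM2l.
have -> : 2 * d * (nrm x ^+ 2 + (d^-1 * nrm (T x)) ^+ 2) =
   2 * d * nrm x ^+ 2 + 2 * (d^-1 * nrm (T x) ^+ 2) by field; rewrite gt_eqF.
set w := nrm (T x); set v := nrm x => h4.
have : d^-1 * w ^+ 2 <= d * v ^+ 2 by lra.
by rewrite mulrC ler_pdivrMr// exprMn; lra.
Qed.

(** Completeness of [H] gives a pointwise limit. Letting one index of the Cauchy bound tend to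
    infinity at each vector turns it into convergence in norm, and one close approximant then
    supplies boundedness. *)
Lemma bop_complete (S : nat -> H -> H) : (forall n, bounded_op (S n)) ->
  (forall e, 0 < e -> exists N, forall m n, (N <= m)%N -> (N <= n)%N ->
     opb (S m - S n) e) ->
  exists X, bounded_op X /\
    forall e, 0 < e -> exists N, forall n, (N <= n)%N -> opb (S n - X) e.
Proof.
move=> bS hS.
have cS x : exists l : H, S n x @[n --> \oo] --> l.
  apply: cauchyHP => e e0.
  have e'0 : 0 < e / (1 + nrm x) by rewrite divr_gt0// ltr_pwDl// nrm_ge0.
  have [N hN] := hS _ e'0; exists N => m n Nm Nn.
  apply: le_trans (hN m n Nm Nn x) _.
  rewrite mulrAC ler_pdivrMr ?ler_wpM2l ?(ltW e0) ?lerDr//.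
  by rewrite ltr_pwDl// nrm_ge0.
have [X hX] := choice cS.
have apx e : 0 < e -> exists N, forall n, (N <= n)%N -> opb (S n - X) e.
  move=> e0; have [N hN] := hS _ e0; exists N => n Nn x.
  apply/ler_addgt0Pr => d d0.
  have /cvgHP/(_ _ d0)[M _ hM] := hX x.
  have /ltW := hM (maxn M N) (leq_maxl _ _).
  have := hN n (maxn M N) Nn (leq_maxr _ _) x.
  change (nrm (S n x - S (maxn M N) x) <= e * nrm x ->
   nrm (S (maxn M N) x - X x) <= d -> nrm (S n x - X x) <= e * nrm x + d).
  by move=> h1 h2; apply: le_trans (nrmBD (S (maxn M N) x) _ _) (lerD h1 h2).
exists X; split=> //; apply/bounded_opP; split.
  move=> k x y; apply/eqP; rewrite -subr_eq0 -normr_eq0 normE.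
  suff : nrm (X (k *: x + y) - (k *: X x + X y)) <= 0.
    by rewrite le_eqVlt ltNge nrm_ge0 orbF => /eqP ->.
  apply/ler_addgt0Pr => d d0; rewrite add0r.
  set m := nrm (k *: x + y) + complex.Re `|k| * nrm x + nrm y.
  have m0 : 0 <= m.
    by rewrite !addr_ge0 ?mulr_ge0 ?nrm_ge0// normc_def sqrtr_ge0.
  have [N hN] := apx (d / (1 + m)) ltac:(by rewrite divr_gt0// ltr_pwDl).
  have := hN N (leqnn N) (k *: x + y); have := hN N (leqnn N) x.
  have := hN N (leqnn N) y.
  rewrite -![(S N - X) _]/(S N _ - X _) (bS N).1.
  set p := S N x; set q := S N y => h1 h2 h3.
  (* The defect of linearity of [X] is a combination of three approximation errors, since [S N] is
     linear. *)
  have -> : X (k *: x + y) - (k *: X x + X y) =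
     - (k *: p + q - X (k *: x + y)) + k *: (p - X x) + (q - X y).
    by rewrite opprB scalerBr -addrA [k *: p - _ + _]addrACA -opprD subrKA.
  have : nrm (- (k *: p + q - X (k *: x + y)) + k *: (p - X x) + (q - X y)) <=
     d / (1 + m) * m.
    apply: le_trans (nrmD _ _) _; rewrite {2}/m mulrDr lerD//.
    apply: le_trans (nrmD _ _) _; rewrite mulrDr lerD ?nrmN//.
    by rewrite nrmZc mulrCA ler_wpM2l// normc_def sqrtr_ge0.
  move=> /le_trans; apply; rewrite mulrAC ler_pdivrMr ?ltr_pwDl//.
  by rewrite ler_wpM2l ?(ltW d0)// lerDr.
have [N hN] := apx 1 ltr01.
have [_ [c c0 hc]] := (bounded_opP (S N)).1 (bS N).
exists (c + 1); first by rewrite addr_ge0.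
move=> x; have := hN N (leqnn N) x; have := hc x => h1 h2.
have -> : X x = S N x - (S N x - X x) by rewrite opprB addrC subrK.
by apply: le_trans (nrmB _ _) _; rewrite mulrDl lerD.
Qed.

Lemma symop_limit X : (forall e, 0 < e -> exists2 S, symop S & opb (S - X) e) ->
  symop X.
Proof.
move=> h x y; apply/eqP; rewrite -subr_eq0 -normr_le0.
apply/ler_addgt0Pr => e e0; rewrite add0r.
have m0 : 0 < 1 + nrm x * nrm y by rewrite ltr_pwDl// mulr_ge0 ?nrm_ge0.
have [S sS hS] := h (e / (2 * (1 + nrm x * nrm y))) ltac:(by rewrite divr_gt0// mulr_gt0).
have -> : rdot (X x) y - rdot x (X y) = rdot x ((S - X) y) - rdot ((S - X) x) y.
  rewrite -![(S - X) _]/(S _ - X _) rdotBl rdotBr sS; ring.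
apply: le_trans (ler_normB _ _) _.
set d := e / _ in hS; have d0 : 0 < d by rewrite divr_gt0// mulr_gt0.
have h1 : `|rdot x ((S - X) y)| <= d * (nrm x * nrm y).
  apply: le_trans (normr_rdot_le _ _) _.
  by rewrite mulrCA ler_wpM2l ?nrm_ge0//; exact: hS.
have h2 : `|rdot ((S - X) x) y| <= d * (nrm x * nrm y).
  apply: le_trans (normr_rdot_le _ _) _.
  by rewrite mulrA ler_wpM2r ?nrm_ge0//; exact: hS.
apply: le_trans (lerD h1 h2) _.
have -> : e = d * (1 + nrm x * nrm y) * 2 by rewrite /d; field; rewrite gt_eqF.
by rewrite -mulrDr -mulrA ler_wpM2l ?(ltW d0)//; lra.
Qed.

Lemma selfadjoint_limit X : bounded_op X ->
  (forall e, 0 < e -> exists2 S, selfadjoint S & opb (S - X) e) -> selfadjoint X.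
Proof.
move=> bX h; apply/selfadjointP; split=> //; apply: symop_limit => e /h[S sS hS].
by exists S => //; exact: selfadjoint_symop.
Qed.

End BoundedOperators.

(** * Invertibility and the spectrum of a selfadjoint operator *)

Section Spectrum.
Context {R : realType} {H : hilbertType R}.
Implicit Types (x y z : H) (a b c e : R) (S T X G K : H -> H).

(** By conversion, [spectrum T z] is the negation of this property for [T - z *: idfun]. *)
Definition invertible_op G :=
  exists S, [/\ bounded_op S, S \o G = idfun & G \o S = idfun].

Lemma invertible_id : invertible_op (idfun : H -> H).
Proof. by exists idfun; split=> //; exact: bop_id. Qed.

Lemma invertible_comp G K : invertible_op G -> invertible_op K ->
  invertible_op (G \o K).
Proof.
move=> [S [bS SG GS]] [T [bT TK KT]]; exists (T \o S); split.
- exact: bop_comp.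
- apply/funext => x /=; rewrite -[S _]/((S \o G) (K x)) SG.
  exact: (congr1 (@^~ x) TK).
- apply/funext => x /=; rewrite -[K _]/((K \o T) (S x)) KT.
  exact: (congr1 (@^~ x) GS).
Qed.

Lemma invertibleZ (k : R[i]) G : linear G -> k != 0 -> invertible_op G ->
  invertible_op (k *: G).
Proof.
move=> lG k0 [S [bS SG GS]]; exists (k^-1 *: S); split; first exact: bopZ.
- apply/funext => x; change (k^-1 *: S (k *: G x) = x).
  by rewrite linZ ?scalerA ?mulVf// ?scale1r; [exact: (congr1 (@^~ x) SG)|case: bS].
- apply/funext => x; change (k *: G (k^-1 *: S x) = x).
  by rewrite linZ// scalerA mulfV// scale1r; exact: (congr1 (@^~ x) GS).
Qed.

Lemma invertible_bounded_below G : invertible_op G ->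
  exists2 c, 0 < c & forall x, nrm x <= c * nrm (G x).
Proof.
move=> [S [/bounded_opP[lS [c c0 hc]] SG _]]; exists (c + 1).
  by rewrite ltr_wpDl.
move=> x; have -> : nrm x = nrm (S (G x)) by rewrite -[S _]/((S \o G) x) SG.
by rewrite (le_trans (hc _))// ler_wpM2r ?nrm_ge0// lerDl.
Qed.

Lemma neumann K c : bounded_op K -> 0 <= c < 1 -> opb K c ->
  invertible_op (idfun - K).
Proof.
move=> bK /andP[c0 c1] hK; have lK := bK.1.
(* [S n] is the partial sum I + K + ... + K^(n-1) of the Neumann series, in Horner form. *)
pose S n := iter n (fun S' x => x + K (S' x)) (0 : H -> H).
have SS n x : S n.+1 x = x + K (S n x) by [].
have bS n : bounded_op (S n).
  elim: n => [|n IH]; first exact: bop0.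
  exact: bopD (@bop_id _ _) (bop_comp bK IH).
have d0 : 0 < (1 - c)^-1 by rewrite invr_gt0 subr_gt0.
have S1 n : opb (S n) (1 - c)^-1.
  elim: n => [|n IH] x; first by rewrite /= nrm0 mulr_ge0 ?nrm_ge0 ?(ltW d0).
  rewrite SS; apply: le_trans (nrmD _ _) _.
  have : nrm (K (S n x)) <= c * ((1 - c)^-1 * nrm x).
    by apply: le_trans (hK _) _; rewrite ler_wpM2l.
  move=> h; have -> : (1 - c)^-1 * nrm x = nrm x + c * ((1 - c)^-1 * nrm x).
    by field; rewrite subr_eq0 eq_sym lt_eqF.
  by rewrite lerD2l.
have S2 n k : opb (S (n + k)%N - S n) (c ^+ n * (1 - c)^-1).
  elim: n => [|n IH] x.
    rewrite expr0 mul1r add0n -[(S k - _) x]/(S k x - 0) subr0; exact: S1.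
  rewrite addSn -[(_ - _) x]/(S (n + k).+1 x - S n.+1 x) !SS.
  rewrite opprD addrACA subrr add0r -linB//; apply: le_trans (hK _) _.
  by rewrite exprS -!mulrA ler_wpM2l// mulrA; exact: IH.
have cvg0 e : 0 < e -> exists N, forall n, (N <= n)%N -> c ^+ n * (1 - c)^-1 <= e.
  move=> e0.
  have /cvgr0Pnorm_le/(_ (e * (1 - c))) : (c ^+ n @[n --> \oo] --> (0 : R)).
    by apply: cvg_expr; rewrite ger0_norm.
  case=> [|N _ hN]; first by rewrite mulr_gt0// subr_gt0.
  exists N => n Nn; rewrite ler_pdivrMr ?subr_gt0//.
  by apply: le_trans (ler_norm _) _; exact: hN.
have S3 m n : (n <= m)%N -> opb (S m - S n) (c ^+ n * (1 - c)^-1).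
  by move=> nm; rewrite -(subnKC nm); exact: S2.
have [|X [bX hX]] := @bop_complete _ _ S bS.
  move=> e /cvg0[N hN]; exists N => m n Nm Nn.
  have [nm|/ltnW mn] := leqP n m.
    by apply: opb_le (S3 _ _ nm); exact: hN.
  move=> x; rewrite -[(S m - S n) x]/(S m x - S n x) nrmBC.
  exact: (opb_le (hN m Nm) (S3 _ _ mn) x).
have XE x : X x = x + K (X x).
  apply/eqP; rewrite -subr_eq0; apply/eqP/nrm_eq0/eqP.
  rewrite eq_le nrm_ge0 andbT; apply/ler_addgt0Pr => e e0; rewrite add0r.
  have m0 : 0 < 2 * (1 + nrm x) by rewrite mulr_gt0// ltr_pwDl// nrm_ge0.
  have [N hN] := hX (e / (2 * (1 + nrm x))) ltac:(by rewrite divr_gt0).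
  have h1 := hN N.+1 (leqnSn _) x; have h2 := hN N (leqnn _) x.
  rewrite -[(S N.+1 - X) x]/(S N.+1 x - X x) in h1.
  rewrite -[(S N - X) x]/(S N x - X x) in h2.
  rewrite nrmBC; apply: le_trans (nrmBD (S N.+1 x) _ _) _.
  rewrite SS opprD addrACA subrr add0r -linB//.
  have h3 : nrm (K (X x - S N x)) <= nrm (S N x - X x).
    by apply: le_trans (hK _) _; rewrite nrmBC ler_piMl ?nrm_ge0 ?(ltW c1).
  apply: le_trans (lerD (le_trans h3 h2) h1) _.
  have -> : e / (2 * (1 + nrm x)) * nrm x + e / (2 * (1 + nrm x)) * nrm x =
    e * nrm x / (1 + nrm x) by field; rewrite gt_eqF// ltr_pwDl// nrm_ge0.
  rewrite ler_pdivrMr ?ltr_pwDl ?nrm_ge0//.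
  by rewrite ler_wpM2l ?(ltW e0)// lerDr.
(* The fixed point equation [XE] makes [X] a right inverse; injectivity of I - K makes it a left
   inverse too. *)
have inj x : x - K x = 0 -> x = 0.
  move=> /eqP; rewrite subr_eq0 => /eqP xK; apply: nrm_eq0.
  apply/eqP; rewrite eq_le nrm_ge0 andbT; have := hK x; rewrite -xK.
  have := nrm_ge0 x; have : 0 < 1 - c by rewrite subr_gt0.
  move: (nrm x) => r; nra.
exists X; split=> //; last first.
  apply/funext => x; change (X x - K (X x) = x).
  by rewrite {1}XE addrK.
apply/funext => x; change (X (x - K x) = x).
apply/eqP; rewrite -subr_eq0; apply/eqP/inj.
have := XE (x - K x); move: (X (x - K x)) => w wE.
have {}wE : w - K w = x - K x by rewrite {1}wE addrK.
by rewrite (linB lK) opprD addrACA -opprD addrC opprD opprK wE addrACA subrr addNr addr0.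
Qed.

(** As in the Lax-Milgram theorem, |x - r G x|^2 is at most (1 - 2 r d + r^2 M^2) |x|^2. The
    minimizing value r = d / M^2 turns the factor into 1 - d^2 / M^2 < 1, so the Neumann series
    inverts r G. *)
Lemma coercive_invertible G d : bounded_op G -> 0 < d ->
  (forall x, d * nrm x ^+ 2 <= rdot (G x) x) -> invertible_op G.
Proof.
move=> bG d0 hG; have [lG [m m0 hm]] := (bounded_opP G).1 bG.
pose M := m + d; have M0 : 0 < M by rewrite ltr_wpDl.
have hM : opb G M by apply: opb_le hm; rewrite lerDl ltW.
pose r := d / M ^+ 2.
have r0 : 0 < r by rewrite divr_gt0// exprn_gt0.
have dM : d ^+ 2 / M ^+ 2 <= 1.
  by rewrite ler_pdivrMr ?exprn_gt0// mul1r lerXn2r ?nnegrE ?(ltW d0) ?(ltW M0)// /M lerDr.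
have rGE : r%:C *: G = idfun - (idfun - r%:C *: G) by rewrite opprB addrC subrK.
suff : invertible_op (r%:C *: G).
  have rn0 : r%:C != 0 by rewrite fmorph_eq0 gt_eqF.
  move=> /(@invertibleZ (r%:C)^-1); rewrite scalerA mulVf// scale1r; apply.
    by case: (bopZ r%:C bG).
  by rewrite invr_eq0.
rewrite rGE; apply: (@neumann _ (Num.sqrt (1 - d ^+ 2 / M ^+ 2))).
- by apply: bopB; [exact: bop_id|exact: bopZ].
- rewrite sqrtr_ge0/= -[X in _ < X]sqrtr1 ltr_sqrt ?ltr01//.
  by rewrite ltrBlDr ltrDl divr_gt0// exprn_gt0.
- move=> x; rewrite -[(_ - _) x]/(x - r%:C *: G x).
  rewrite -(@ler_pXn2r _ 2)// ?nnegrE ?mulr_ge0 ?nrm_ge0 ?sqrtr_ge0//.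
  rewrite exprMn sqr_sqrtr ?subr_ge0// nrmB_sqr nrmZ ger0_norm ?(ltW r0)//.
  rewrite rdotZr rdotC.
  have h1 := hG x.
  have h2 : nrm (G x) ^+ 2 <= M ^+ 2 * nrm x ^+ 2.
    by rewrite -exprMn lerXn2r ?nnegrE ?mulr_ge0 ?nrm_ge0 ?(ltW M0)//; exact: hM.
  have h3 : r * (d * nrm x ^+ 2) <= r * rdot (G x) x by rewrite ler_pM2l.
  have h4 : r ^+ 2 * nrm (G x) ^+ 2 <= r ^+ 2 * (M ^+ 2 * nrm x ^+ 2).
    by rewrite ler_wpM2l ?sqr_ge0.
  have E1 : r * (d * nrm x ^+ 2) = d ^+ 2 / M ^+ 2 * nrm x ^+ 2.
    by rewrite /r; field; rewrite gt_eqF.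
  have E2 : r ^+ 2 * (M ^+ 2 * nrm x ^+ 2) = d ^+ 2 / M ^+ 2 * nrm x ^+ 2.
    by rewrite /r; field; rewrite gt_eqF.
  by rewrite exprMn mulrBl mul1r; lra.
Qed.

(** If [z] is off the real segment from [m] to [M], one of the multiples of T - z by 1, -1, 'i, - 'i
    is coercive, with constant the distance by which [z] violates the corresponding bound. *)
Lemma spectrum_form_bounds T m M (z : R[i]) : selfadjoint T ->
  (forall x, m * nrm x ^+ 2 <= rdot (T x) x) ->
  (forall x, rdot (T x) x <= M * nrm x ^+ 2) ->
  spectrum T z -> complex.Im z = 0 /\ m <= complex.Re z <= M.
Proof.
move=> sT hm hM; apply: contra_notP => hz; rewrite -/(invertible_op _).
have bT : bounded_op (T - z *: idfun).
  by apply: bopB; [exact: selfadjoint_bop|exact/bopZ/bop_id].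
have TE x : dotp ((T - z *: idfun) x) x = dotp (T x) x - z * (nrm x ^+ 2)%:C.
  change (dotp (T x - z *: x) x = dotp (T x) x - z * (nrm x ^+ 2)%:C).
  by rewrite linearBl linearZl_LR/= dotp_re.
have im x : complex.Im (dotp (T x) x) = 0.
  have := dotpC (T x) x; rewrite -sT.2.
  by case: (dotp (T x) x) => u v [] /=; lra.
have red (k : R[i]) d : k != 0 -> 0 < d ->
    (forall x, d * nrm x ^+ 2 <= rdot (k *: (T - z *: idfun) x) x) ->
    invertible_op (T - z *: idfun).
  move=> k0 d0 hk; have : invertible_op (k *: (T - z *: idfun)).
    by apply: (@coercive_invertible _ d) => //; exact: bopZ.
  move=> /(@invertibleZ k^-1); rewrite scalerA mulVf// scale1r; apply.
    by case: (bopZ k bT).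
  by rewrite invr_eq0.
have n0 x : 0 <= nrm x ^+ 2 by rewrite exprn_ge0// nrm_ge0.
have TR x : rdot ((T - z *: idfun) x) x = rdot (T x) x - complex.Re z * nrm x ^+ 2.
  by rewrite /rdot TE; case: (dotp (T x) x) => u v; case: (z) => s t /=; ring.
have TI x : rdot ('i *: (T - z *: idfun) x) x = complex.Im z * nrm x ^+ 2.
  rewrite rdotZil TE; have := im x; case: (dotp (T x) x) => u v; case: (z) => s t /= ->; ring.
have i0 : 'i != 0 :> R[i] by rewrite eq_complex/= oner_eq0 andbF.
have [iz|iz|iz] := ltgtP (complex.Im z) 0.
- apply: (red (- 'i) (- complex.Im z)) => [||x]; rewrite ?oppr_eq0 ?oppr_gt0//.
  by rewrite scaleNr rdotNl TI mulNr.
- by apply: (red 'i (complex.Im z)) => // x; rewrite TI.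
- have [mz|zm] := leP m (complex.Re z); last first.
    apply: (red 1 (m - complex.Re z)) => [||x]; rewrite ?oner_eq0 ?subr_gt0//.
    by rewrite scale1r TR mulrBl lerD2r.
  have [zM|Mz] := leP (complex.Re z) M; first by case: hz; split; rewrite ?mz.
  apply: (red (-1) (complex.Re z - M)) => [||x]; rewrite ?oppr_eq0 ?oner_eq0 ?subr_gt0//.
  by rewrite scaleN1r rdotNl TR opprB mulrBl lerD2l lerN2.
Qed.

(** The supremum m of the form on the unit sphere need not be attained. Cauchy-Schwarz for the
    nonnegative form of P = m - T gives |P x|^2 <= b <P x, x>. If P were invertible, |x| <= k |P x|
    would keep <P x, x> above 1 / (k^2 (b + 1)) on the unit sphere, contradicting the choice of
    m. *)
Lemma form_max_in_spectrum T : selfadjoint T -> (exists x : H, x != 0) ->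
  exists2 m : R, forall x, rdot (T x) x <= m * nrm x ^+ 2 & spectrum T m%:C.
Proof.
move=> sT [x0 x00].
have [lT [c c0 hc]] := (bounded_opP T).1 (selfadjoint_bop sT).
pose E := [set rdot (T x) x | x in [set x : H | nrm x = 1]].
have ubE : has_ubound E.
  exists c => _ [x /= x1 <-]; apply: le_trans (rdot_le _ _) _.
  by rewrite x1 mulr1; apply: le_trans (hc x) _; rewrite x1 mulr1.
have nrm_unit x : nrm x != 0 -> nrm ((nrm x)^-1%:C *: x) = 1.
  by move=> nx; rewrite nrmZ ger0_norm ?invr_ge0 ?nrm_ge0// mulVf.
have nx0 x : x != 0 -> nrm x != 0.
  by apply: contra => /eqP/nrm_eq0 ->.
have hE : has_sup E.
  split=> //; exists (rdot (T ((nrm x0)^-1%:C *: x0)) ((nrm x0)^-1%:C *: x0)).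
  by exists ((nrm x0)^-1%:C *: x0) => //=; exact/nrm_unit/nx0.
pose m := sup E.
have hm x : rdot (T x) x <= m * nrm x ^+ 2.
  have [->|/nx0 xn0] := eqVneq x 0.
    by rewrite lin0// rdot0l nrm0 expr0n mulr0.
  have : rdot (T ((nrm x)^-1%:C *: x)) ((nrm x)^-1%:C *: x) <= m.
    by apply: ub_le_sup => //; exists ((nrm x)^-1%:C *: x) => //=; exact/nrm_unit.
  rewrite linZ// rdotZl rdotZr mulrA -expr2 exprVn mulrC ler_pdivrMr//.
  by rewrite exprn_gt0// lt_neqAle eq_sym xn0 nrm_ge0.
exists m => //; rewrite /spectrum/= -/(invertible_op _) => /invertible_bounded_below[k k0 hk].
pose P x := m%:C *: x - T x.
have qge x : 0 <= rdot (P x) x.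
  by rewrite rdotBl rdotZl rdotxx subr_ge0.
have [_ [b b0 hb]] := (bounded_opP (m%:C *: idfun - T)).1
  (bopB (bopZ m%:C (@bop_id _ _)) (selfadjoint_bop sT)).
have {}hk x : nrm x <= k * nrm (P x).
  by rewrite /P nrmBC; exact: hk.
have sP x y : rdot (P x) y = rdot (P y) x.
  rewrite /P !rdotBl !rdotZl (rdotC y x) (selfadjoint_symop sT y x).
  by rewrite (rdotC y (T x)).
have qD u v w : rdot (P (u + v)) w = rdot (P u) w + rdot (P v) w.
  by rewrite -rdotDl /P scalerDr (linD lT) opprD addrACA.
have qZ a u v : rdot (P (a%:C *: u)) v = a * rdot (P u) v.
  by rewrite -rdotZl; congr (rdot _ _); rewrite /P scalerBr (linZ lT) !scalerA mulrC.
have CS x : nrm (P x) ^+ 2 <= b * rdot (P x) x.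
  have := form_cauchy_schwarz qge sP qD qZ x (P x); rewrite rdotxx.
  have h : rdot (P (P x)) (P x) <= b * nrm (P x) ^+ 2.
    apply: le_trans (rdot_le _ _) _; rewrite expr2 mulrA ler_wpM2r ?nrm_ge0//.
  move=> /le_trans/(_ (ler_wpM2l (qge x) h)).
  have [->|px0] := eqVneq (nrm (P x)) 0; first by rewrite expr0n/= => _; rewrite mulr_ge0.
  have : 0 < nrm (P x) ^+ 2 by rewrite exprn_gt0// lt_neqAle eq_sym px0 nrm_ge0.
  by move: (nrm (P x) ^+ 2) (rdot _ _) => u v u0; rewrite mulrA expr2 ler_pM2r// mulrC.
pose d := (k ^+ 2 * (b + 1))^-1.
have d0 : 0 < d by rewrite invr_gt0 mulr_gt0 ?exprn_gt0// ltr_wpDl.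
have [_ [x /= x1 <-]] := sup_adherent d0 hE; rewrite -/m.
have h1 : 1 <= k ^+ 2 * nrm (P x) ^+ 2.
  by rewrite -exprMn -{1}(expr1n _ 2) -x1 lerXn2r ?nnegrE ?mulr_ge0 ?nrm_ge0 ?(ltW k0).
have h2 : 1 <= k ^+ 2 * (b + 1) * rdot (P x) x.
  apply: le_trans h1 _; rewrite -mulrA ler_wpM2l ?sqr_ge0//.
  by apply: le_trans (CS x) _; rewrite ler_wpM2r// lerDl.
have h3 : d <= rdot (P x) x.
  by rewrite /d -[leLHS]mul1r ler_pdivrMr ?mulr_gt0 ?exprn_gt0 ?ltr_wpDl// mulrC.
by move: h3; rewrite rdotBl rdotZl rdotxx x1 expr1n mulr1; lra.
Qed.

End Spectrum.

(** * Polynomials of a selfadjoint operator *)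

Section PolynomialCalculus.
Context {R : realType} {H : hilbertType R}.
Implicit Types (x y : H) (z : R[i]) (a b c e t : R) (S T : H -> H) (q : {poly R}) (p : {poly R[i]}).

(** Complex coefficients make room for the linear factors used in [spectrum_op_poly]. *)
Definition cop_poly p T : H -> H := \sum_(k < size p) p`_k *: iter k T.

Lemma op_sumE n (F : 'I_n -> H -> H) x : (\sum_(i < n) F i) x = \sum_(i < n) F i x.
Proof. by rewrite fct_sumE. Qed.

Lemma cop_polyE n p T x : (size p <= n)%N ->
  cop_poly p T x = \sum_(k < n) p`_k *: iter k T x.
Proof.
move=> pn; rewrite /cop_poly op_sumE (big_ord_widen n (fun k => p`_k *: iter k T x))//.
rewrite big_mkcond/=; apply: eq_bigr => i _.
by case: ltnP => // /(nth_default 0) ->; rewrite scale0r.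
Qed.

Lemma op_polyE q T : op_poly q T = cop_poly (map_poly (real_complex R) q) T.
Proof.
rewrite /op_poly /cop_poly size_map_poly; apply: eq_bigr => i _.
by rewrite coef_map.
Qed.

Lemma cop_polyD p1 p2 T x : cop_poly (p1 + p2) T x = cop_poly p1 T x + cop_poly p2 T x.
Proof.
pose n := maxn (size p1) (size p2).
rewrite !(@cop_polyE n) ?leq_maxl ?leq_maxr ?size_polyD//.
by rewrite -big_split/=; apply: eq_bigr => i _; rewrite coefD scalerDl.
Qed.

Lemma cop_polyZ k p T x : cop_poly (k *: p) T x = k *: cop_poly p T x.
Proof.
rewrite !(@cop_polyE (size p)) ?size_scale_leq// scaler_sumr.
by apply: eq_bigr => i _; rewrite coefZ scalerA.
Qed.

Lemma cop_polyN p T x : cop_poly (- p) T x = - cop_poly p T x.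
Proof. by rewrite -scaleN1r cop_polyZ scaleN1r. Qed.

Lemma cop_polyC k T x : cop_poly k%:P T x = k *: x.
Proof.
by rewrite (@cop_polyE 1) ?size_polyC_leq1// big_ord1 coefC eqxx.
Qed.

Lemma cop_polyMX p T x : cop_poly (p * 'X) T x = cop_poly p T (T x).
Proof.
rewrite (@cop_polyE (size p).+1); last first.
  by rewrite (leq_trans (size_polyMleq _ _))// size_polyX addn2.
rewrite (@cop_polyE (size p))// big_ord_recl coefMX eqxx scale0r add0r.
by apply: eq_bigr => i _; rewrite coefMX/= -iterSr.
Qed.

Lemma bop_iter T k : bounded_op T -> bounded_op (iter k T).
Proof.
by move=> bT; elim: k => [|k IH]; [exact: bop_id|exact: (bop_comp bT IH)].
Qed.

Lemma bop_cop_poly p T : bounded_op T -> bounded_op (cop_poly p T).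
Proof. by move=> bT; apply: bop_sum => i; exact/bopZ/bop_iter. Qed.

Lemma invertible_cop_prod T (r : seq R[i]) : bounded_op T ->
  (forall z, z \in r -> ~ spectrum T z) ->
  invertible_op (cop_poly (\prod_(z <- r) ('X - z%:P)) T).
Proof.
move=> bT; elim: r => [|z r IH] hr.
  have -> : cop_poly (\prod_(z <- [::]) ('X - z%:P)) T = idfun.
    by apply/funext => x; rewrite big_nil -[1]/(1%:P) cop_polyC scale1r.
  exact: invertible_id.
rewrite big_cons.
have -> : cop_poly (('X - z%:P) * \prod_(j <- r) ('X - j%:P)) T =
    cop_poly (\prod_(j <- r) ('X - j%:P)) T \o (T - z *: idfun).
  apply/funext => x /=; move: (\prod_(j <- r) _) => p.
  rewrite mulrBl mul_polyC mulrC cop_polyD cop_polyN cop_polyZ cop_polyMX.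
  have lp := (bop_cop_poly p bT).1.
  by rewrite -[(T - _) x]/(T x - z *: x) (linB lp) (linZ lp).
apply: invertible_comp; first by apply: IH => w wr; apply: hr; rewrite in_cons wr orbT.
by apply: contrapT => hz; apply: (hr z); rewrite ?mem_head.
Qed.

Lemma op_polyD q1 q2 T : op_poly (q1 + q2) T = op_poly q1 T + op_poly q2 T.
Proof. by apply/funext => x; rewrite !op_polyE rmorphD cop_polyD. Qed.

Lemma op_polyN q T : op_poly (- q) T = - op_poly q T.
Proof. by apply/funext => x; rewrite !op_polyE rmorphN/= cop_polyN. Qed.

Lemma op_polyB q1 q2 T : op_poly (q1 - q2) T = op_poly q1 T - op_poly q2 T.
Proof. by rewrite op_polyD op_polyN. Qed.

Lemma op_polyC c T x : op_poly c%:P T x = c%:C *: x.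
Proof. by rewrite op_polyE map_polyC cop_polyC. Qed.

Lemma op_polyMX q T x : op_poly (q * 'X) T x = op_poly q T (T x).
Proof. by rewrite !op_polyE rmorphM/= map_polyX cop_polyMX. Qed.

Lemma selfadjoint_iter T k : selfadjoint T -> selfadjoint (iter k T).
Proof.
move=> sT; elim: k => [|k /selfadjointP[bk sk]]; first exact: selfadjoint_id.
apply/selfadjointP; split; first exact: bop_comp (selfadjoint_bop sT) bk.
by move=> x y; rewrite iterS (selfadjoint_symop sT) sk -iterSr.
Qed.

Lemma selfadjoint_op_poly q T : selfadjoint T -> selfadjoint (op_poly q T).
Proof.
by move=> sT; apply: selfadjoint_sum => i; exact/selfadjointZ/selfadjoint_iter.
Qed.

Lemma bop_op_poly q T : bounded_op T -> bounded_op (op_poly q T).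
Proof. by rewrite op_polyE; exact: bop_cop_poly. Qed.

Lemma selfadjoint_form_bounds T : selfadjoint T ->
  exists c, forall x, - c * nrm x ^+ 2 <= rdot (T x) x <= c * nrm x ^+ 2.
Proof.
move=> sT; have [lT [c c0 hc]] := (bounded_opP T).1 (selfadjoint_bop sT).
exists c => x; rewrite mulNr -ler_norml (le_trans (normr_rdot_le _ _))//.
by rewrite expr2 mulrA ler_wpM2r ?nrm_ge0.
Qed.

Lemma selfadjoint_spectrum_real T (z : R[i]) : selfadjoint T -> spectrum T z ->
  z = (complex.Re z)%:C.
Proof.
move=> sT zT; have [c hc] := selfadjoint_form_bounds sT.
have [|x|] := spectrum_form_bounds sT _ _ zT (m := - c) (M := c).
- by move=> x; case/andP: (hc x).
- by case/andP: (hc x).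
- by case: (z) => u v /= -> _.
Qed.

Lemma spectrum_op_poly q T (m : R) : selfadjoint T -> (exists x : H, x != 0) ->
  spectrum (op_poly q T) m%:C -> exists2 t : R, spectrum T t%:C & q.[t] = m.
Proof.
move=> sT Hn sm; have bT := selfadjoint_bop sT.
(* For constant [q] there is nothing to factor, and any spectral point of [T] serves; one exists
   because the form of [T] has its maximum in the spectrum. *)
have [/eqP|p0] := eqVneq (q - m%:P) 0.
  rewrite subr_eq0 => /eqP ->; have [t _ tT] := form_max_in_spectrum sT Hn.
  by exists t => //; rewrite hornerC.
set p := map_poly (real_complex R) (q - m%:P).
have pE : cop_poly p T = op_poly q T - m%:C *: idfun.
  by apply/funext => x; rewrite -op_polyE op_polyB -[LHS]/(_ x - _ x) op_polyC.
have [r pr] := closed_field_poly_normal p.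
have [h|h] := pselect (forall z, z \in r -> ~ spectrum T z).
  exfalso; apply: sm; rewrite -/(invertible_op _) -pE pr.
  have -> : cop_poly (lead_coef p *: \prod_(z <- r) ('X - z%:P)) T =
     lead_coef p *: cop_poly (\prod_(z <- r) ('X - z%:P)) T.
    by apply/funext => x; rewrite cop_polyZ.
  apply: invertibleZ; [by case: (bop_cop_poly (\prod_(z <- r) ('X - z%:P)) bT)| |].
    by rewrite lead_coef_eq0 map_poly_eq0.
  exact: invertible_cop_prod.
have [z /not_implyP[zr /contrapT zT]] := (existsNP _).2 h.
have zE := selfadjoint_spectrum_real sT zT.
exists (complex.Re z); first by rewrite -zE.
have : root p z by rewrite pr rootZ ?lead_coef_eq0 ?map_poly_eq0// root_prod_XsubC.
rewrite zE /root /p horner_map fmorph_eq0 hornerD hornerN hornerC subr_eq0.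
by move/eqP.
Qed.

Lemma op_poly_form_le q T c : selfadjoint T ->
  (forall t, spectrum T t%:C -> q.[t] <= c) ->
  forall x, rdot (op_poly q T x) x <= c * nrm x ^+ 2.
Proof.
move=> sT hq x; have sq := selfadjoint_op_poly q sT.
have [->|x0] := eqVneq x 0.
  by rewrite lin0; [rewrite rdot0l nrm0 expr0n mulr0|exact: (selfadjoint_bop sq).1].
have [m hm] := form_max_in_spectrum sq (ex_intro _ x x0).
move=> /(spectrum_op_poly sT (ex_intro _ x x0))[t tT qt].
by apply: le_trans (hm x) _; rewrite ler_wpM2r ?exprn_ge0 ?nrm_ge0// -qt hq.
Qed.

Lemma op_poly_opb q T c : selfadjoint T -> 0 <= c ->
  (forall t, spectrum T t%:C -> `|q.[t]| <= c) -> opb (op_poly q T) c.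
Proof.
move=> sT c0 hq; have sq := selfadjoint_op_poly q sT.
apply: symop_opb => //; [by case: sq => [[]]|exact: selfadjoint_symop|].
move=> x; rewrite ler_norml op_poly_form_le ?andbT; last 2 first.
- by [].
- by move=> t /hq; rewrite ler_norml => /andP[].
rewrite lerNl -rdotNl.
have -> : - op_poly q T x = op_poly (- q) T x by rewrite op_polyN.
apply: op_poly_form_le => // t /hq; rewrite hornerN ler_norml lerNl.
by case/andP.
Qed.

(** The bound [D] is carried through the induction for the sake of the product rule q(S) S - q(T) T
    = (q(S) - q(T)) S + q(T) (S - T). *)
Lemma op_poly_lipschitz q r : 0 <= r -> exists C D, [/\ 0 <= C, 0 <= D,
  (forall T, bounded_op T -> opb T r -> opb (op_poly q T) D) &
  forall S T d, bounded_op S -> bounded_op T -> opb S r -> opb T r -> 0 <= d ->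
    opb (S - T) d -> opb (op_poly q S - op_poly q T) (C * d)].
Proof.
move=> r0; elim/poly_ind: q => [|q c [C [D [C0 D0 hD hC]]]].
  have z T : op_poly 0 T = 0 :> (H -> H).
    by apply/funext => x; rewrite -[0]/(0%:P) op_polyC scale0r.
  exists 0, 0; split=> // [T _ _ x|S T d _ _ _ _ d0 _ x].
    by rewrite z nrm0 mul0r.
  by rewrite !z subr0 nrm0 !mul0r.
have E T x : op_poly (q * 'X + c%:P) T x = op_poly q T (T x) + c%:C *: x.
  by rewrite op_polyD -[LHS]/(_ x + _ x) op_polyMX op_polyC.
exists (C * r + D), (D * r + `|c|); split.
- by rewrite addr_ge0// mulr_ge0.
- by rewrite addr_ge0// mulr_ge0.
- move=> T bT hT x; rewrite E; apply: le_trans (nrmD _ _) _.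
  rewrite mulrDl nrmZ lerD2r; apply: le_trans (hD T bT hT _) _.
  by rewrite -mulrA ler_wpM2l.
- move=> S T d bS bT hS hT d0 hd x.
  rewrite -[(_ - _) x]/(op_poly _ S x - op_poly _ T x) !E opprD addrACA subrr addr0.
  rewrite -(subrKA (op_poly q T (S x))) -linB; last exact: (bop_op_poly q bT).1.
  apply: le_trans (nrmD _ _) _; rewrite !mulrDl; apply: lerD.
    apply: le_trans (hC S T d bS bT hS hT d0 hd (S x)) _.
    by rewrite (mulrAC C r) -(mulrA (C * d)) ler_wpM2l ?mulr_ge0.
  apply: le_trans (hD T bT hT _) _.
  by rewrite -mulrA ler_wpM2l//; exact: hd.
Qed.

End PolynomialCalculus.

(** * Weierstrass approximation *)

Section Weierstrass.
Context {R : realType}.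
Implicit Types (f g h : R -> R) (a b c d e t x : R) (n k : nat).

Lemma uniform_cvgP (D : set R) (u : nat -> R -> R) f :
  {uniform D, u @ \oo --> f} <->
  (forall e, 0 < e -> exists N, forall n, (N <= n)%N ->
     forall t, D t -> `|u n t - f t| < e).
Proof.
split=> [uf e e0|h].
  have /uf[N _ hN] : nbhs (f : {uniform` D -> R})
      [set g | forall t, D t -> `|g t - f t| < e].
    apply/uniform_nbhs; exists [set xy | ball xy.1 e xy.2]; split.
      exact: entourage_ball (PosNum e0).
    by move=> g /= + t Dt => /(_ t Dt); rewrite -ball_normE /ball_/= distrC.
  by exists N => n Nn; exact: hN.
move=> P /uniform_nbhs[E [+ EP]]; rewrite -entourage_ballE => -[e e0 eE].
have [N hN] := h e e0; exists N => // n Nn; apply: EP => t Dt; apply: eE.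
by rewrite /= -ball_normE /ball_/= distrC; exact: hN.
Qed.

Lemma within_continuousP f a b t : {within `[a, b], continuous f} -> a <= t <= b ->
  forall e, 0 < e -> exists2 d, 0 < d &
    forall s, a <= s <= b -> `|t - s| < d -> `|f t - f s| < e.
Proof.
move=> /subspace_continuousP/(_ t)/= + tab e e0; rewrite in_itv/= => /(_ tab).
move=> /cvgrPdist_lt/(_ _ e0); rewrite near_withinE => -[d /= d0 hd].
by exists d => // s sab ts; apply: hd; rewrite /= ?in_itv.
Qed.

(** Heine-Cantor: [compact_near_coveringP] turns the radii valid near each point into a common
    one. *)
Lemma segment_unif_continuous f a b : {within `[a, b], continuous f} ->
  forall e, 0 < e -> exists2 d, 0 < d &
    forall s t, a <= s <= b -> a <= t <= b -> `|s - t| < d -> `|f s - f t| < e.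
Proof.
move=> cf e e0.
(* The last premise makes [P] vacuous outside the segment, as neighbourhoods of [x] are taken in the
   whole line. *)
pose P d x := forall t, a <= t <= b -> `|x - t| < d -> a <= x <= b -> `|f x - f t| < e.
have /compact_near_coveringP/(_ R (0^'+)%R P _) := @segment_compact R a b.
case=> [x /=|d /= d0 hd].
  rewrite in_itv/= => xab.
  have [d d0 hd] := within_continuousP cf xab (divr_gt0 e0 (ltr0n _ 2)).
  have d20 : 0 < d / 2 by rewrite divr_gt0.
  exists (ball x (d / 2), [set d' | d' < d / 2]) => /=.
    by split; [exact: nbhsx_ballx|exact: nbhs_right_lt].
  move=> [y d'] [/=]; rewrite -ball_normE /ball_/= => xy dd' t tab yt yab.
  have := hd _ yab; have := hd _ tab.
  have -> : x - t = (x - y) + (y - t) by rewrite subrKA.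
  move=> /(_ _)h1 /(_ _)h2.
  have xt : `|x - y + (y - t)| < d.
    by apply: le_lt_trans (ler_normD _ _) _; rewrite [ltRHS]splitr ltrD// (lt_trans yt).
  have xyd : `|x - y| < d by rewrite (lt_trans xy)// ltr_pdivrMr// ltr_pMr// ltr1n.
  have {}h1 := h1 xt; have {}h2 := h2 xyd.
  rewrite (_ : f y - f t = (f x - f t) - (f x - f y)); last by ring.
  by apply: le_lt_trans (ler_normB _ _) _; rewrite [ltRHS]splitr ltrD.
exists (d / 2); first by rewrite divr_gt0.
move=> s t sab tab st.
have d20 : 0 < d / 2 by rewrite divr_gt0.
apply: (hd (d / 2) _ _ s) => //=; rewrite ?in_itv//.
by rewrite sub0r normrN gtr0_norm// ltr_pdivrMr// ltr_pMr// ltr1n.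
Qed.

(* [bernstein n h] is the n-th Bernstein polynomial with nodal values h 0, ..., h n:
   its value at t is the mean of h under the binomial law of parameters n and t. *)
Fixpoint bernstein n (h : nat -> R) : {poly R} :=
  if n is n'.+1 then
    (1 - 'X) * bernstein n' h + 'X * bernstein n' (fun k => h k.+1)
  else (h 0%N)%:P.

Lemma bernsteinS n (h : nat -> R) t : (bernstein n.+1 h).[t] =
  (1 - t) * (bernstein n h).[t] + t * (bernstein n (fun k => h k.+1)).[t].
Proof. by rewrite /= !hornerE. Qed.

Lemma bernstein_le n (h h' : nat -> R) t : 0 <= t <= 1 ->
  (forall k, (k <= n)%N -> h k <= h' k) ->
  (bernstein n h).[t] <= (bernstein n h').[t].
Proof.
move=> /andP[t0 t1]; elim: n h h' => [|n IH] h h' hh'.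
  by rewrite /= !hornerC hh'.
rewrite !bernsteinS; apply: lerD; apply: ler_wpM2l; rewrite ?subr_ge0//.
  by apply: IH => k kn; rewrite hh'// leqW.
by apply: IH => k kn; rewrite hh'.
Qed.

(** The mean of (k - c)^2 under the binomial law is the variance n t (1 - t) plus the squared bias.
    The centre [c] varies in the induction because the second recursive branch shifts the nodes. *)
Lemma bernstein_quadratic n (A Q c t : R) :
  (bernstein n (fun k => A + Q * (k%:R - c) ^+ 2)).[t] =
  A + Q * (n%:R * t * (1 - t) + (n%:R * t - c) ^+ 2).
Proof.
elim: n c => [|n IH] c; first by rewrite /= hornerC; ring.
rewrite bernsteinS IH.
under [X in bernstein n X]eq_fun do rewrite -natr1 -addrA.
have -> : (fun k => A + Q * (k%:R + (1 - c)) ^+ 2) =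
   (fun k : nat => A + Q * (k%:R - (c - 1)) ^+ 2) by apply/funext => k; rewrite opprB.
by rewrite IH -natr1; ring.
Qed.

Lemma invn_small e : 0 < e -> exists N, forall n, (N <= n)%N -> n.+1%:R^-1 < e.
Proof.
move=> e0; exists (Num.trunc e^-1) => n Nn.
rewrite -[ltRHS]invrK ltf_pV2 ?posrE ?invr_gt0//.
by apply: lt_le_trans (truncnS_gt _) _; rewrite ler_nat ltnS.
Qed.

(** Chebyshev's argument: nodes close to x are handled by uniform continuity, and at the others 2 M
    is at most 2 M ((k / n - x) / d)^2. The resulting parabolas around f(x) enclose the nodal
    values, and their Bernstein polynomials are known exactly. *)
Lemma weierstrass01 f : {within `[0, 1], continuous f} ->
  forall e, 0 < e -> exists q : {poly R}, forall t, 0 <= t <= 1 -> `|q.[t] - f t| <= e.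
Proof.
move=> cf e e0.
have [M M0 hM] : exists2 M, 0 < M & forall t, 0 <= t <= 1 -> `|f t| <= M.
  have [u _ hu] := EVT_max ler01 cf; have [v _ hv] := EVT_min ler01 cf.
  exists (1 + `|f u| + `|f v|) => [|t t01]; first by rewrite -addrA ltr_pwDl ?addr_ge0.
  have := hu t; have := hv t; rewrite !in_itv/= => /(_ t01) h1 /(_ t01) h2.
  rewrite ler_norml; have := ler_norm (f u); have := ler_norm (- f v); rewrite normrN.
  have := normr_ge0 (f u); have := normr_ge0 (f v); lra.
have [d d0 hd] := segment_unif_continuous cf (divr_gt0 e0 (ltr0n _ 2)).
(* n > K is what brings the variance term, at most 2 M / (d^2 n), below e / 2. *)
pose K := 4 * M / (d ^+ 2 * e).
pose n := (Num.trunc K).+1.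
have nK : K < n%:R := truncnS_gt K.
have n0 : 0 < n%:R :> R by rewrite ltr0n.
pose Q := 2 * M / (d ^+ 2 * n%:R ^+ 2).
have Q0 : 0 <= Q by rewrite divr_ge0 ?mulr_ge0 ?sqr_ge0// ltW.
pose h k := f (k%:R / n%:R).
exists (bernstein n h) => x x01.
have near k : (k <= n)%N -> `|h k - f x| <= e / 2 + Q * (k%:R - n%:R * x) ^+ 2.
  move=> kn; have k01 : 0 <= (k%:R / n%:R : R) <= 1.
    by rewrite divr_ge0//= ler_pdivrMr// mul1r ler_nat.
  have [kx|kx] := ltP `|k%:R / n%:R - x| d.
    apply: le_trans (ltW (hd _ _ k01 x01 kx)) _.
    by rewrite lerDl mulr_ge0// sqr_ge0.
  apply: le_trans (ler_normB _ _) _.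
  have h1 : `|h k| + `|f x| <= 2 * M by rewrite mulr_natl lerD// hM.
  apply: le_trans h1 _.
  have -> : Q * (k%:R - n%:R * x) ^+ 2 = 2 * M * ((k%:R / n%:R - x) ^+ 2 / d ^+ 2).
    by rewrite /Q; field; rewrite !gt_eqF.
  rewrite ler_wpDl ?divr_ge0 ?(ltW e0)// ler_peMr ?mulr_ge0 ?(ltW M0)//.
  rewrite ler_pdivlMr ?exprn_gt0// mul1r -[leRHS]real_normK ?num_real//.
  by rewrite lerXn2r ?nnegrE ?(ltW d0).
have V : Q * (n%:R * x * (1 - x) + (n%:R * x - n%:R * x) ^+ 2) <= e / 2.
  rewrite subrr expr0n addr0.
  have -> : Q * (n%:R * x * (1 - x)) = 2 * M / (d ^+ 2 * n%:R) * (x * (1 - x)).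
    by rewrite /Q; field; rewrite !gt_eqF.
  have h1 : 2 * M / (d ^+ 2 * n%:R) <= e / 2.
    rewrite ler_pdivrMr ?mulr_gt0 ?exprn_gt0//.
    have : K * (d ^+ 2 * e) = 4 * M by rewrite /K divfK// mulf_neq0 ?expf_neq0 ?gt_eqF.
    have : K * (d ^+ 2 * e) < n%:R * (d ^+ 2 * e) by rewrite ltr_pM2r// mulr_gt0 ?exprn_gt0.
    by move: (d ^+ 2) (n%:R : R) => u v; nra.
  apply: le_trans h1; rewrite ler_piMr ?divr_ge0 ?mulr_ge0 ?sqr_ge0 ?(ltW M0) ?(ltW n0) ?(ltW d0)//.
  by case/andP: x01; nra.
rewrite ler_norml; apply/andP; split.
  have : (bernstein n (fun k => (f x - e / 2) + (- Q) * (k%:R - n%:R * x) ^+ 2)).[x]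
      <= (bernstein n h).[x].
    apply: bernstein_le => // k /near; rewrite ler_norml => /andP[+ _].
    by rewrite mulNr; lra.
  rewrite bernstein_quadratic mulNr; lra.
have : (bernstein n h).[x] <=
    (bernstein n (fun k => (f x + e / 2) + Q * (k%:R - n%:R * x) ^+ 2)).[x].
  apply: bernstein_le => // k /near; rewrite ler_norml => /andP[_].
  lra.
rewrite bernstein_quadratic; lra.
Qed.

Lemma weierstrass f a b : {within `[a, b], continuous f} ->
  forall e, 0 < e -> exists q : {poly R}, forall t, a <= t <= b -> `|q.[t] - f t| <= e.
Proof.
move=> cf e e0.
have [ab|ba] := ltP a b; last first.
  exists (f a)%:P => t /andP[at_ tb]; rewrite hornerC.
  have -> : t = a by apply: le_anti; rewrite at_ (le_trans tb).
  by rewrite subrr normr0 ltW.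
have ab0 : 0 < b - a by rewrite subr_gt0.
pose g s := f (a + (b - a) * s).
have cg : {within `[0, 1], continuous g}.
  apply/subspace_continuousP => s /=; rewrite in_itv/= => s01.
  have tab : a <= a + (b - a) * s <= b by nra.
  apply/cvgrPdist_lt => d d0.
  have [r r0 hr] := within_continuousP cf tab d0.
  rewrite near_withinE; exists (r / (b - a)); first by rewrite /= divr_gt0.
  move=> u /= su; rewrite in_itv/= => u01; apply: hr; first nra.
  rewrite (_ : _ - _ = (b - a) * (s - u)); last ring.
  by rewrite normrM gtr0_norm// mulrC -ltr_pdivlMr.
have [q hq] := weierstrass01 cg e0.
exists (q \Po ((b - a)^-1 *: ('X - a%:P))) => t tab.
rewrite horner_comp !hornerE/=.
have := hq ((b - a)^-1 * (t - a)); rewrite /g mulVKf ?gt_eqF// (addrC a) subrK; apply.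
rewrite mulrC divr_ge0 ?subr_ge0 ?(ltW ab)//=; last by case/andP: tab.
by rewrite ler_pdivrMr// mul1r lerD2r; case/andP: tab.
Qed.

End Weierstrass.

(** * The continuous functional calculus along a segment *)

Section FunctionalCalculus.
Context {R : realType} {H : hilbertType R}.
Implicit Types (x y : H) (a b c d e r s t m M : R) (A B S T X : H -> H) (f : R -> R)
  (I : interval R).

Lemma opb_linear_limit T c : linear T -> 0 <= c ->
  (forall e, 0 < e -> opb T (c + e)) -> opb T c.
Proof.
move=> lT c0 h x; apply/ler_addgt0Pr => e e0.
have d0 : 0 < 1 + nrm x by rewrite ltr_pwDl// nrm_ge0.
apply: le_trans (h _ (divr_gt0 e0 d0) x) _.
rewrite mulrDl lerD2l mulrAC ler_pdivrMr// ler_wpM2l ?(ltW e0)//.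
by rewrite lerDr.
Qed.

Lemma opbD S T c d : opb S c -> opb T d -> opb (S + T) (c + d).
Proof.
move=> hS hT x; apply: le_trans (nrmD _ _) _.
by rewrite mulrDl; apply: lerD; [exact: hS|exact: hT].
Qed.

Lemma opbN T c : opb T c -> opb (- T) c.
Proof. by move=> hT x; rewrite -[(- T) x]/(- T x) nrmN. Qed.

Lemma opbB S T c d : opb S c -> opb T d -> opb (S - T) (c + d).
Proof. by move=> hS /opbN; exact: opbD. Qed.

Lemma opbBC S T c : opb (S - T) c -> opb (T - S) c.
Proof. by move=> /opbN; rewrite opprB. Qed.

(** Comparing [q] with the polynomials hidden in [is_cfc] frees f(T) from them: one polynomial,
    chosen independently of [T], approximates f(T) for every [T] with spectrum in a given compact
    interval. *)
Lemma is_cfc_approx f T X (q : {poly R}) e : selfadjoint T -> is_cfc f T X -> 0 <= e ->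
  (forall t, spectrum T t%:C -> `|q.[t] - f t| <= e) -> opb (op_poly q T - X) e.
Proof.
move=> sT [bX [u [/uniform_cvgP hu hX]]] e0 hq.
have bT := selfadjoint_bop sT.
have bu n : bounded_op (op_poly (u n) T - X) by apply: bopB; [exact: bop_op_poly|].
have {}hX := (opnorm_cvg0P bu).1 hX.
apply: opb_linear_limit => //; first by case: (bopB (bop_op_poly q bT) bX).
move=> d d0; have [N hN] := hu (d / 2) ltac:(by rewrite divr_gt0).
have [N' hN'] := hX (d / 2) ltac:(by rewrite divr_gt0).
pose n := maxn N N'.
have -> : e + d = (e + d / 2) + d / 2 by field.
rewrite -(subrKA (op_poly (u n) T)); apply: opbD; last first.
  by apply: hN'; rewrite leq_maxr.
rewrite -op_polyB; apply: op_poly_opb => //.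
  by rewrite addr_ge0// divr_ge0// ltW.
move=> t tT; rewrite hornerD hornerN.
rewrite (_ : _ - _ = (q.[t] - f t) - ((u n).[t] - f t)); last ring.
apply: le_trans (ler_normB _ _) _; apply: lerD; first exact: hq.
by apply/ltW/hN => //; rewrite leq_maxl.
Qed.

(** Weierstrass polynomials on [a, b] give a Cauchy sequence of operators, since [op_poly_opb]
    bounds the differences; its limit is what [get] needs. *)
Lemma cfcP f T a b : selfadjoint T -> (forall t, spectrum T t%:C -> a <= t <= b) ->
  {within `[a, b], continuous f} -> is_cfc f T (cfc f T).
Proof.
move=> sT hT cf; apply: getPex.
have bT := selfadjoint_bop sT.
have /choice[u hu] : forall n : nat, exists q : {poly R},
    forall t, a <= t <= b -> `|q.[t] - f t| <= n.+1%:R^-1.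
  by move=> n; apply: weierstrass => //; rewrite invr_gt0.
have [||X [bX hX]] := @bop_complete _ _ (fun n => op_poly (u n) T).
- by move=> n; exact: bop_op_poly.
- move=> e e0; have [N hN] := @invn_small R (e / 2) ltac:(by rewrite divr_gt0).
  exists N => m n Nm Nn; rewrite -op_polyB; apply: op_poly_opb => //; first exact: ltW.
  move=> t tT; rewrite hornerD hornerN.
  rewrite (_ : _ - _ = ((u m).[t] - f t) - ((u n).[t] - f t)); last ring.
  apply: le_trans (ler_normB _ _) _; rewrite [leRHS]splitr; apply: lerD.
    by apply: le_trans (hu m _ (hT _ tT)) (ltW (hN _ Nm)).
  by apply: le_trans (hu n _ (hT _ tT)) (ltW (hN _ Nn)).
exists X; split=> //; exists u; split.
  apply/uniform_cvgP => e /invn_small[N hN]; exists N => n Nn t tT.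
  by apply: le_lt_trans (hu n _ (hT _ tT)) (hN _ Nn).
apply/opnorm_cvg0P => [n|//]; apply: bopB => //; exact: bop_op_poly.
Qed.

Lemma is_cfc_selfadjoint f T X : selfadjoint T -> is_cfc f T X -> selfadjoint X.
Proof.
move=> sT [bX [u [_ hX]]]; apply: selfadjoint_limit => // e e0.
have [|N hN] := (opnorm_cvg0P _).1 hX e e0.
  by move=> n; apply: bopB => //; exact/bop_op_poly/selfadjoint_bop.
by exists (op_poly (u N) T); [exact: selfadjoint_op_poly|exact: hN].
Qed.

(** Both bounds lie in [I] because they are spectral points: the maximum of the form of [T], and
    minus the maximum of the form of - T. *)
Lemma SA_form_bounds I T : SA I T -> (exists x : H, x != 0) ->
  exists m M, [/\ m \in I, M \in I &
    forall x, m * nrm x ^+ 2 <= rdot (T x) x <= M * nrm x ^+ 2].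
Proof.
move=> [sT hT] Hn.
have [M hM MT] := form_max_in_spectrum sT Hn.
(* As a polynomial in [T], the operator - T has its spectral points carried back to [T] by
   [spectrum_op_poly]. *)
have nT : op_poly (- 'X) T = - T.
  apply/funext => x; rewrite op_polyN -['X]mul1r -[1]/(1%:P).
  by rewrite -[LHS]/(- _ x) op_polyMX op_polyC scale1r.
have sNT : selfadjoint (op_poly (- 'X) T) := selfadjoint_op_poly _ sT.
have [m hm /(spectrum_op_poly sT Hn)[t tT]] := form_max_in_spectrum sNT Hn.
rewrite !hornerE => tm; exists t, M; split.
- by have [u uI /complexI <-] := hT _ tT.
- by have [u uI /complexI <-] := hT _ MT.
- move=> x; rewrite hM andbT; have := hm x.
  by rewrite nT -[(- T) x]/(- T x) rdotNl -tm mulNr lerN2.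
Qed.

(** Bounds on forms, unlike spectra, pass to convex combinations. They place all spectra along the
    segment in one compact interval, on which Weierstrass approximation applies. *)
Lemma SA_segment I A B : SA I A -> SA I B -> (exists x : H, x != 0) ->
  exists m M, [/\ m \in I, M \in I & forall t, 0 <= t <= 1 ->
    let T := t%:C *: A + (1 - t)%:C *: B in
    SA I T /\ forall s, spectrum T s%:C -> m <= s <= M].
Proof.
move=> sA sB Hn.
have [m1 [M1 [m1I M1I h1]]] := SA_form_bounds sA Hn.
have [m2 [M2 [m2I M2I h2]]] := SA_form_bounds sB Hn.
pose m := Num.min m1 m2; pose M := Num.max M1 M2.
have mI : m \in I by rewrite /m minElt; case: ifP.
have MI : M \in I by rewrite /M maxElt; case: ifP.
exists m, M; split=> // t /andP[t0 t1] T.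
have sT : selfadjoint T.
  by apply: selfadjointD; apply: selfadjointZ; [case: sA|case: sB].
have hT z : spectrum T z -> complex.Im z = 0 /\ m <= complex.Re z <= M.
  apply: spectrum_form_bounds => // x.
    rewrite -[T x]/(t%:C *: A x + (1 - t)%:C *: B x) rdotDl !rdotZl.
    have /andP[hu _] := h1 x; have /andP[hv _] := h2 x.
    have mm1 : m <= m1 by rewrite ge_min lexx.
    have mm2 : m <= m2 by rewrite ge_min lexx orbT.
    have n0 : 0 <= nrm x ^+ 2 by rewrite sqr_ge0.
    have {}hu := le_trans (ler_wpM2r n0 mm1) hu.
    have {}hv := le_trans (ler_wpM2r n0 mm2) hv.
    move: (rdot (A x) x) (rdot (B x) x) hu hv => u v hu hv; nra.
  rewrite -[T x]/(t%:C *: A x + (1 - t)%:C *: B x) rdotDl !rdotZl.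
  have /andP[_ hu] := h1 x; have /andP[_ hv] := h2 x.
  have mm1 : M1 <= M by rewrite le_max lexx.
  have mm2 : M2 <= M by rewrite le_max lexx orbT.
  have n0 : 0 <= nrm x ^+ 2 by rewrite sqr_ge0.
  have {}hu := le_trans hu (ler_wpM2r n0 mm1).
  have {}hv := le_trans hv (ler_wpM2r n0 mm2).
  move: (rdot (A x) x) (rdot (B x) x) hu hv => u v hu hv; nra.
split=> [|s /hT[]//]; split=> // z zT.
exists (complex.Re z); last by rewrite -(selfadjoint_spectrum_real sT zT).
by apply: (interval_is_interval mI MI); case: (hT _ zT).
Qed.

(** One polynomial approximates [f] on the common compact interval, hence F(t) uniformly in t;
    boundedness and norm continuity are inherited from that polynomial of T(t), the latter by an e/3
    argument. *)
Lemma cfc_segment I f A B : {within [set` I], continuous f} ->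
  SA I A -> SA I B -> (exists x : H, x != 0) ->
  let F t := cfc f (t%:C *: A + (1 - t)%:C *: B) in
  [/\ forall t, 0 <= t <= 1 -> selfadjoint (F t),
      exists2 c, 0 <= c & forall t, 0 <= t <= 1 -> opb (F t) c &
      forall e, 0 < e -> exists2 d, 0 < d & forall s t, 0 <= s <= 1 -> 0 <= t <= 1 ->
        `|s - t| < d -> opb (F s - F t) e].
Proof.
move=> cf sA sB Hn F; pose T t := t%:C *: A + (1 - t)%:C *: B.
have [m [M [mI MI hT]]] := SA_segment sA sB Hn.
have {}cf : {within `[m, M], continuous f}.
  apply: continuous_subspaceW cf => s /=; rewrite in_itv/=.
  exact: (interval_is_interval mI MI).
have sT t : 0 <= t <= 1 -> selfadjoint (T t) by move=> /hT[[]].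
have cT t : 0 <= t <= 1 -> is_cfc f (T t) (F t).
  move=> t01; apply: (@cfcP _ _ m M) => //; first exact: sT.
  by case: (hT t t01).
have apx (q : {poly R}) e : 0 <= e -> (forall s, m <= s <= M -> `|q.[s] - f s| <= e) ->
    forall t, 0 <= t <= 1 -> opb (op_poly q (T t) - F t) e.
  move=> e0 hq t t01; apply: is_cfc_approx => //; [exact: sT|exact: cT|].
  by move=> s sT'; apply: hq; case: (hT t t01) => _; exact.
have [_ [a a0 ha]] := (bounded_opP A).1 (selfadjoint_bop sA.1).
have [_ [b b0 hb]] := (bounded_opP B).1 (selfadjoint_bop sB.1).
have hTb t : 0 <= t <= 1 -> opb (T t) (a + b).
  move=> /andP[t0 t1]; apply: opbD => x.
    rewrite -[(_ *: _) x]/(t%:C *: A x) nrmZ ger0_norm//.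
    by apply: le_trans (ha x); rewrite ler_piMl ?nrm_ge0.
  rewrite -[(_ *: _) x]/((1 - t)%:C *: B x) nrmZ ger0_norm ?subr_ge0//.
  by apply: le_trans (hb x); rewrite ler_piMl ?nrm_ge0// gerBl.
have hTd s t : opb (T s - T t) (`|s - t| * (a + b)).
  move=> x.
  have -> : (T s - T t) x = (s - t)%:C *: (A x - B x).
    rewrite -[LHS]/((s%:C *: A x + (1 - s)%:C *: B x) - (t%:C *: A x + (1 - t)%:C *: B x)).
    rewrite opprD addrACA -!scalerBl -!rmorphB/= scalerBr -scaleNr -rmorphN.
    by congr (_ + _%:C *: _); ring.
  rewrite nrmZ -mulrA ler_wpM2l//; apply: le_trans (nrmB _ _) _.
  by rewrite mulrDl; apply: lerD; [exact: ha|exact: hb].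
split=> [t t01||e e0].
- exact: is_cfc_selfadjoint (sT t t01) (cT t t01).
- have [q hq] := weierstrass cf ltr01.
  have [C [D [C0 D0 hD _]]] := @op_poly_lipschitz _ H q _ (addr_ge0 a0 b0).
  exists (D + 1); first by rewrite addr_ge0.
  move=> t t01; have -> : F t = op_poly q (T t) - (op_poly q (T t) - F t).
    by rewrite opprB addrC subrK.
  apply: opbB; last exact: apx.
  by apply: hD; [exact/selfadjoint_bop/sT|exact: hTb].
- have [q hq] := weierstrass cf (divr_gt0 e0 (ltr0n _ 3)).
  have e30 : 0 <= e / 3 by rewrite divr_ge0 ?ltW.
  have [C [D [C0 D0 _ hC]]] := @op_poly_lipschitz _ H q _ (addr_ge0 a0 b0).
  pose K := C * (a + b) + 1.
  have K0 : 0 < K by rewrite ltr_wpDl ?mulr_ge0 ?addr_ge0.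
  exists (e / 3 / K); first by rewrite !divr_gt0.
  move=> s t s01 t01 st.
  have -> : F s - F t = (F s - op_poly q (T s)) +
      ((op_poly q (T s) - op_poly q (T t)) + (op_poly q (T t) - F t)).
    by rewrite !subrKA.
  have -> : e = e / 3 + (e / 3 + e / 3) by field.
  apply: opbD; first exact/opbBC/apx.
  apply: opbD; last exact: apx.
  have := hC (T s) (T t) _ (selfadjoint_bop (sT s s01)) (selfadjoint_bop (sT t t01))
    (hTb s s01) (hTb t t01) _ (hTd s t).
  rewrite mulr_ge0 ?addr_ge0// => /(_ isT); apply: opb_le.
  move: st; rewrite ltr_pdivlMr// => /ltW; apply: le_trans.
  by rewrite mulrCA ler_wpM2l// lerDl.
Qed.

End FunctionalCalculus.

(** * Riemann sums for a symmetric monotone weight *)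

Section Riemann.
Context {R : realType}.
Implicit Types (a b c d e s t : R) (g h p V : R -> R) (l : seq R) (xi : nat -> R).

Local Notation mu := (@lebesgue_measure R).

(** This is the condition of [is_op_integral], with a free left end [a] so that induction on the
    partition is possible. *)
Definition tagged d a l xi := forall k, (k < size l)%N ->
  nth 0 (a :: l) k <= xi k <= nth 0 l k /\ nth 0 l k - nth 0 (a :: l) k < d.

Lemma path_lt_le a l : path <%O a l -> a <= last a l.
Proof.
by elim: l a => //= b l IH a /andP[ab /IH]; apply: le_trans; exact: ltW.
Qed.

Lemma Rintegral_osc g a b c e : a < b -> mu.-integrable `]a, b] (EFin \o g) ->
  (forall t, a < t <= b -> `|g t - c| <= e) ->
  `|(b - a) * c - \int[mu]_(t in `]a, b]) g t| <= e * (b - a).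
Proof.
move=> ab ig hg.
have cst (k : R) : mu.-integrable `]a, b] (EFin \o cst k).
  apply: measurable_bounded_integrable => //=.
    by rewrite lebesgue_measure_itv/= lte_fin ab -EFinB ltry.
  exact: bounded_cst.
have icst (k : R) : \int[mu]_(t in `]a, b]) k = k * (b - a).
  by rewrite Rintegral_cst//= lebesgue_measure_itv/= lte_fin ab.
have lo : \int[mu]_(t in `]a, b]) (c - e) <= \int[mu]_(t in `]a, b]) g t.
  apply: le_Rintegral => //; first exact: cst.
  move=> t /=; rewrite in_itv/= => /hg; rewrite ler_norml => /andP[+ _]; lra.
have hi : \int[mu]_(t in `]a, b]) g t <= \int[mu]_(t in `]a, b]) (c + e).
  apply: le_Rintegral => //; first exact: cst.
  move=> t /=; rewrite in_itv/= => /hg; rewrite ler_norml => /andP[_]; lra.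
move: lo hi; rewrite !icst; move: (\int[mu]_(t in _) g t) => J lo hi.
by rewrite ler_norml; clear -lo hi; apply/andP; split; lra.
Qed.

(** On a cell the error is at most the oscillation e + C (V b - V a) times the length. Summing the
    first terms gives the total length; in the second ones the length is replaced by [d], and the
    increments of [V] telescope. *)
Lemma riemann_error g V e C d : mu.-integrable `[0, 1] (EFin \o g) ->
  0 <= C -> 0 <= d ->
  (forall s t, 0 <= s -> s <= t -> t <= 1 -> V s <= V t) ->
  (forall s t, 0 <= s <= 1 -> 0 <= t <= 1 -> `|s - t| < d ->
     `|g s - g t| <= e + C * `|V s - V t|) ->
  forall l a xi, 0 <= a -> path <%O a l -> last a l <= 1 -> tagged d a l xi ->
  `|\sum_(k < size l) (nth 0 l k - nth 0 (a :: l) k) * g (xi k)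
     - \int[mu]_(t in `]a, last a l]) g t|
  <= e * (last a l - a) + C * d * (V (last a l) - V a).
Proof.
move=> ig C0 d0 mV hg; elim=> [|b l IH] a xi a0 /=.
  move=> _ _ _; rewrite big_ord0 set_itvoc0 Rintegral_set0 !subrr normr0 !mulr0.
  by rewrite addr0.
move=> /andP[ab bl] l1 tg.
have bl' := path_lt_le bl.
have b0 : 0 <= b by rewrite (le_trans a0)// ltW.
have b1 : b <= 1 by rewrite (le_trans bl').
have igS (u v : R) : 0 <= u -> v <= 1 -> mu.-integrable `]u, v] (EFin \o g).
  move=> u0 v1; apply: integrableS ig => // t /=; rewrite !in_itv/= => /andP[ut tv].
  by rewrite (le_trans tv)// (le_trans u0)// ltW.
have tgb : tagged d b l (fun k => xi k.+1) by move=> k kl; exact: (tg k.+1).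
have {tgb}IHb := IH b _ b0 bl l1 tgb.
have [/= /andP[ax xb] bad] := tg 0%N isT.
have VE : V a <= V b by apply: mV => //; exact: ltW.
have H0 : `|(b - a) * g (xi 0%N) - \int[mu]_(t in `]a, b]) g t| <=
    (e + C * (V b - V a)) * (b - a).
  apply: Rintegral_osc ab (igS _ _ a0 b1) _ => t /andP[at_ tb].
  have h0 : 0 <= t <= 1 by rewrite (le_trans tb)// (le_trans a0)// ltW.
  have h1 : 0 <= xi 0%N <= 1 by rewrite (le_trans xb)// (le_trans a0).
  apply: le_trans (hg _ _ h0 h1 _) _.
    by rewrite ltr_norml; apply/andP; split; lra.
  rewrite lerD2l ler_wpM2l// ler_norml.
  have := mV t b; have := mV a t; have := mV (xi 0%N) b; have := mV a (xi 0%N).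
  case/andP: h0 => t0 t1; case/andP: h1 => x0 x1.
  move=> /(_ a0 ax x1) v1 /(_ x0 xb b1) v2 /(_ a0 (ltW at_) t1) v3 /(_ t0 tb b1) v4.
  by apply/andP; split; lra.
have -> : \int[mu]_(t in `]a, last b l]) g t =
    \int[mu]_(t in `]a, b]) g t + \int[mu]_(t in `]b, last b l]) g t.
  rewrite -(@Rintegral_itvB _ g (BRight a) (BRight (last b l)) b).
  - by rewrite addrC subrK.
  - exact: igS.
  - by rewrite bnd_simp ltW.
  - by rewrite bnd_simp.
rewrite big_ord_recl/=.
set S := \sum_(_ < _) _ in IHb *.
set I1 := \int[mu]_(t in `]a, b]) g t in H0 *.
set I2 := \int[mu]_(t in _) g t in IHb *.
rewrite (_ : _ - _ = ((b - a) * g (xi 0%N) - I1) + (S - I2)); last by ring.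
apply: le_trans (ler_normD _ _) _.
apply: le_trans (lerD H0 IHb) _.
have : C * (V b - V a) * (b - a) <= C * (V b - V a) * d.
  by rewrite ler_wpM2l ?mulr_ge0 ?subr_ge0// ltW.
by move: (V b) (V a) (V _) => v1 v2 v3; lra.
Qed.

End Riemann.

(** * Bounded variation of a symmetric monotone weight *)

Section SymmetricMonotone.
Context {R : realType}.
Implicit Types (a b c d e s t : R) (h V : R -> R) (l : seq R) (xi : nat -> R).
Variable p : R -> R.
Hypothesis psym : forall t : R, 0 <= t <= 1 -> p (1 - t) = p t.
Hypothesis pmono : forall s t : R, 0 <= s -> s <= t -> t <= 1 / 2 -> p s <= p t.

Local Notation mu := (@lebesgue_measure R).

(** Clamping to [0, 1/2] makes this monotone on the whole line. On [0, 1], [psymE] writes [p] as its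
    sum with its reflection, minus a constant. *)
Definition left_part t := p (Num.max 0 (Num.min t (1 / 2))).
(** In an increment of [p] the two monotone pieces of [psymE] have opposite signs; here their
    absolute values add up, so the increments of this function dominate those of [p]. *)
Definition variation t := left_part t - left_part (1 - t).

Lemma left_part_homo : {homo left_part : s t / s <= t}.
Proof.
move=> s t st; rewrite /left_part; apply: pmono.
- by rewrite le_max lexx.
- by rewrite ge_max !le_max lexx/=; apply/orP; right; rewrite le_min !ge_min st lexx orbT.
- by rewrite ge_max ge_min lexx orbT andbT divr_ge0.
Qed.

Lemma left_partE t : 0 <= t -> t <= 1 / 2 -> left_part t = p t.
Proof. by move=> t0 t1; rewrite /left_part (min_idPl t1) (max_idPr t0). Qed.

Lemma left_partE' t : 1 / 2 <= t -> left_part t = p (1 / 2).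
Proof. by move=> t1; rewrite /left_part (min_idPr t1) (max_idPr _)// divr_ge0. Qed.

Lemma psymE t : 0 <= t <= 1 -> p t = left_part t + left_part (1 - t) - p (1 / 2).
Proof.
move=> /[dup] t01 /andP[t0 t1]; have [th|th] := leP t (1 / 2).
  by rewrite left_partE// left_partE' ?addrK//; lra.
rewrite left_partE' ?(ltW th)// left_partE; [|lra|lra].
by rewrite psym// addrC addKr.
Qed.

Lemma variation_homo s t : s <= t -> variation s <= variation t.
Proof.
move=> st; rewrite /variation; apply: lerD; first exact: left_part_homo.
by rewrite lerN2; apply: left_part_homo; rewrite lerD2l lerN2.
Qed.

Lemma p_variation s t : 0 <= s <= 1 -> 0 <= t <= 1 ->
  `|p s - p t| <= `|variation s - variation t|.
Proof.
wlog st : s t / s <= t => [hw s01 t01|s01 t01].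
  have [st|/ltW ts] := leP s t; first exact: hw.
  by rewrite distrC (distrC (variation s)); exact: hw.
rewrite (distrC (variation s)) (@ger0_norm _ (variation t - _)) ?subr_ge0 ?variation_homo//.
rewrite (psymE s01) (psymE t01) /variation.
have h1 := left_part_homo st.
have /left_part_homo h2 : 1 - t <= 1 - s by rewrite lerD2l lerN2.
by rewrite ler_norml; apply/andP; split; lra.
Qed.

Lemma p_bounds t : 0 <= t <= 1 -> p 0 <= p t <= p (1 / 2).
Proof.
move=> /[dup] t01 /andP[t0 t1]; have [th|th] := leP t (1 / 2).
  by apply/andP; split; apply: pmono.
by rewrite -(psym t01); apply/andP; split; apply: pmono; lra.
Qed.

Lemma p_norm_le t : 0 <= t <= 1 -> `|p t| <= `|p 0| + `|p (1 / 2)|.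
Proof.
move=> /p_bounds /andP[h1 h2].
have := ler_norm (p (1 / 2)); have := ler_norm (- p 0); rewrite normrN.
have := normr_ge0 (p (1 / 2)); have := normr_ge0 (p 0).
by rewrite ler_norml => *; apply/andP; split; lra.
Qed.

Lemma measurable_symmetric_monotone : measurable_fun (`[0, 1]%classic : set R) p.
Proof.
apply: (eq_measurable_fun
    (fun t => (left_part t - (- left_part (1 - t))) - p (1 / 2))).
  by move=> t; rewrite inE/= in_itv/= => /psymE ->; rewrite opprK.
apply: measurable_funB => //; apply: measurable_funB.
  exact: (nondecreasing_measurable _ left_part_homo).
apply: nondecreasing_measurable => // s t st.
by rewrite lerN2; apply: left_part_homo; rewrite lerD2l lerN2.
Qed.

(** In p(s) h(s) - p(t) h(t) = p(s) (h(s) - h(t)) + h(t) (p(s) - p(t)), the first term is small by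
    uniform continuity of [h], and the second is controlled by [variation]. *)
Lemma p_riemann h c e d l xi :
  (forall t, 0 <= t <= 1 -> `|h t| <= c) -> 0 <= c -> 0 <= e ->
  {within `[0, 1], continuous h} -> 0 <= d ->
  (forall s t, 0 <= s <= 1 -> 0 <= t <= 1 -> `|s - t| < d -> `|h s - h t| <= e) ->
  itv_partition 0 1 l -> tagged d 0 l xi ->
  `|\sum_(k < size l) (nth 0 l k - nth 0 (0 :: l) k) * (p (xi k) * h (xi k))
     - \int[mu]_(t in `[0, 1]) (p t * h t)|
  <= (`|p 0| + `|p (1 / 2)|) * e + c * d * (variation 1 - variation 0).
Proof.
move=> hc c0 e0 ch d0 hd [pl /eqP l1] tg.
set P := `|p 0| + _; have P0 : 0 <= P by rewrite addr_ge0.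
pose g t := p t * h t.
have ig : mu.-integrable `[0, 1] (EFin \o g).
  apply: measurable_bounded_integrable => //=.
  - by rewrite lebesgue_measure_itv/= lte_fin ltr01 -EFinB ltry.
  - apply: measurable_funM; first exact: measurable_symmetric_monotone.
    exact: subspace_continuous_measurable_fun.
  - exists (P * c); split; first exact: num_real.
    move=> M PM t /=; rewrite in_itv/= => t01; apply: le_trans (ltW PM).
    by rewrite normrM ler_pM ?p_norm_le ?hc.
have hV s t : 0 <= s -> s <= t -> t <= 1 -> variation s <= variation t.
  by move=> _ st _; exact: variation_homo.
have hg s t : 0 <= s <= 1 -> 0 <= t <= 1 -> `|s - t| < d ->
    `|g s - g t| <= P * e + c * `|variation s - variation t|.
  move=> s01 t01 st.
  rewrite /g (_ : _ - _ = p s * (h s - h t) + h t * (p s - p t)); last by ring.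
  apply: le_trans (ler_normD _ _) _; rewrite !normrM; apply: lerD.
    by apply: ler_pM => //; [exact: p_norm_le|exact: hd].
  by apply: ler_pM => //; [exact: hc|exact: p_variation].
have := riemann_error ig c0 d0 hV hg (lexx _) pl _ tg.
rewrite l1 => /(_ (lexx _)); rewrite subr0 mulr1 Rintegral_itv_obnd_cbnd//.
by apply: integrableS ig => // t /=; rewrite !in_itv/= => /andP[/ltW -> ->].
Qed.

End SymmetricMonotone.

(** * Operator-valued Riemann integrals *)

Section OperatorIntegral.
Context {R : realType} {H : hilbertType R}.
Implicit Types (x y : H) (a b c d e s t : R) (l : seq R) (xi : nat -> R) (n k : nat)
  (G : R -> H -> H) (X : H -> H).

Definition opsum l xi G : H -> H :=
  \sum_(k < size l) (nth 0 l k - nth 0 (0 :: l) k)%:C *: G (xi k).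

Definition upart n : seq R := mkseq (fun k => k.+1%:R / n.+1%:R) n.+1.
(** Midpoints are permuted by t -> 1 - t, which keeps symmetrization exact on finite sums. *)
Definition utag n k : R := (k%:R + 1 / 2) / n.+1%:R.

Lemma nth_upart n k : (k < n.+1)%N -> nth 0 (upart n) k = k.+1%:R / n.+1%:R.
Proof. exact: nth_mkseq. Qed.

Lemma nth_upart0 n k : (k < n.+1)%N -> nth 0 (0 :: upart n) k = k%:R / n.+1%:R.
Proof. by case: k => [|k] kn /=; rewrite ?mul0r// nth_upart// ltnW. Qed.

Lemma upart_step n k : (k < n.+1)%N ->
  nth 0 (upart n) k - nth 0 (0 :: upart n) k = n.+1%:R^-1.
Proof.
by move=> kn; rewrite nth_upart// nth_upart0// -mulrBl -natr1 addrAC subrr add0r mul1r.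
Qed.

Lemma upart_partition n : itv_partition 0 1 (upart n).
Proof.
split.
  apply/(pathP 0) => k; rewrite size_mkseq => kn.
  by rewrite -subr_gt0 upart_step// invr_gt0.
by rewrite (last_nth 0) size_mkseq /= nth_upart// divff.
Qed.

Lemma tagged_upart d n : n.+1%:R^-1 < d -> tagged d 0 (upart n) (utag n).
Proof.
move=> nd k; rewrite size_mkseq => kn; rewrite upart_step//; split=> //.
rewrite nth_upart0// nth_upart// /utag -natr1.
by rewrite !ler_pM2r ?invr_gt0//; apply/andP; split; lra.
Qed.

Lemma tag01 d l xi : itv_partition 0 1 l -> tagged d 0 l xi ->
  forall k, (k < size l)%N -> 0 <= xi k <= 1.
Proof.
move=> pl tg k kl; have [/andP[h1 h2] _] := tg k kl.
rewrite (le_trans _ h1)/=; last first.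
  rewrite (set_nth_default 1) /=; last by rewrite ltnS ltnW.
  by rewrite (itv_partition_nth_ge _ pl)// ltnS ltnW.
rewrite (le_trans h2)//.
have /= : nth 1 (0 :: l) k.+1 <= 1 by apply: (itv_partition_nth_le _ pl).
by rewrite (set_nth_default 0).
Qed.

Lemma sum_upart n (u : nat -> R) :
  \sum_(k < size (upart n)) (nth 0 (upart n) k - nth 0 (0 :: upart n) k) * u k =
  \sum_(k < n.+1) n.+1%:R^-1 * u k.
Proof.
rewrite -(big_mkord xpredT (fun k =>
  (nth 0 (upart n) k - nth 0 (0 :: upart n) k) * u k)) size_mkseq big_mkord.
by apply: eq_bigr => k _; rewrite upart_step.
Qed.

Lemma opsum_upart n G : opsum (upart n) (utag n) G =
  \sum_(k < n.+1) (n.+1%:R^-1)%:C *: G (utag n k).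
Proof.
rewrite /opsum -(big_mkord xpredT (fun k =>
  (nth 0 (upart n) k - nth 0 (0 :: upart n) k)%:C *: G (utag n k))) size_mkseq big_mkord.
by apply: eq_bigr => k _; rewrite upart_step.
Qed.

Lemma rdot_opsum l xi G x y : rdot (opsum l xi G x) y =
  \sum_(k < size l) (nth 0 l k - nth 0 (0 :: l) k) * rdot (G (xi k) x) y.
Proof.
rewrite /opsum op_sumE rdot_suml; apply: eq_bigr => k _.
by rewrite -[(_ *: G _) x]/(_ *: (G _ x)) rdotZl.
Qed.

Variables (p : R -> R) (F : R -> H -> H) (c : R).
Hypothesis psym : forall t : R, 0 <= t <= 1 -> p (1 - t) = p t.
Hypothesis pmono : forall s t : R, 0 <= s -> s <= t -> t <= 1 / 2 -> p s <= p t.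
Hypothesis bF : forall t, 0 <= t <= 1 -> bounded_op (F t).
Hypothesis c0 : 0 <= c.
Hypothesis hF : forall t, 0 <= t <= 1 -> opb (F t) c.
Hypothesis cF : forall e, 0 < e -> exists2 d, 0 < d & forall s t, 0 <= s <= 1 ->
  0 <= t <= 1 -> `|s - t| < d -> opb (F s - F t) e.

Let G t := (p t)%:C *: F t.

Lemma bounded_opsum d l xi : itv_partition 0 1 l -> tagged d 0 l xi ->
  bounded_op (opsum l xi G).
Proof.
by move=> pl tg; apply: bop_sum => k; apply: bopZ; apply/bopZ/bF/(tag01 pl tg).
Qed.

(** The mesh [d] does not depend on [x] and [y], and the error scales with their norms; this is what
    makes the scalar estimate an estimate in operator norm. *)
Lemma opsum_form_close e : 0 < e -> exists2 d, 0 < d & forall l xi,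
  itv_partition 0 1 l -> tagged d 0 l xi -> forall x y,
  `|rdot (opsum l xi G x) y -
    \int[lebesgue_measure]_(t in `[0, 1]) (p t * rdot (F t x) y)| <= e * (nrm x * nrm y).
Proof.
move=> e0; pose P := `|p 0| + `|p (1 / 2)|; have P0 : 0 <= P by rewrite addr_ge0.
pose D := variation p 1 - variation p 0.
have D0 : 0 <= D by rewrite subr_ge0; apply: variation_homo.
(* Half of [e] is spent on the oscillation of [F] and half on the variation of [p]; the added 1
   keeps the denominators positive. *)
have r0 : 0 < e / (2 * (P + 1)) by rewrite divr_gt0// mulr_gt0// ltr_wpDl.
have [d1 d10 hd1] := cF r0.
pose d2 := e / (2 * (c * D + 1)).
have cD0 : 0 < c * D + 1 by rewrite ltr_wpDl// mulr_ge0.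
have d20 : 0 < d2 by rewrite divr_gt0// mulr_gt0.
exists (Num.min d1 d2); first by rewrite lt_min d10.
move=> l xi pl tg x y; set d := Num.min d1 d2 in tg.
have d0 : 0 <= d by rewrite le_min !ltW.
have n0 : 0 <= nrm x * nrm y by rewrite mulr_ge0 ?nrm_ge0.
have osc r s t : opb (F s - F t) r -> `|rdot (F s x) y - rdot (F t x) y| <= r * (nrm x * nrm y).
  move=> h; rewrite -rdotBl; apply: le_trans (normr_rdot_le _ _) _.
  by rewrite mulrA ler_wpM2r ?nrm_ge0//; exact: h.
have ch : {within `[0, 1], continuous (fun t => rdot (F t x) y)}.
  apply/subspace_continuousP => s /=; rewrite in_itv/= => s01.
  apply/cvgrPdist_lt => r rr0.
  have m0 : 0 < nrm x * nrm y + 1 by rewrite ltr_wpDl.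
  have [r1 r10 hr1] := cF (divr_gt0 rr0 m0).
  rewrite near_withinE; exists r1 => // t /= st; rewrite in_itv/= => t01.
  apply: le_lt_trans (osc _ _ _ (hr1 s t s01 t01 st)) _.
  by rewrite mulrAC ltr_pdivrMr// ltr_pM2l// ltrDl.
have hc t : 0 <= t <= 1 -> `|rdot (F t x) y| <= c * (nrm x * nrm y).
  move=> t01; apply: le_trans (normr_rdot_le _ _) _.
  by rewrite mulrA ler_wpM2r ?nrm_ge0//; exact: hF.
have := @p_riemann _ p psym pmono (fun t => rdot (F t x) y) (c * (nrm x * nrm y))
  (e / (2 * (P + 1)) * (nrm x * nrm y)) d l xi hc (mulr_ge0 c0 n0)
  (mulr_ge0 (ltW r0) n0) ch d0 _ pl tg.
have hosc s t : 0 <= s <= 1 -> 0 <= t <= 1 -> `|s - t| < d ->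
    `|rdot (F s x) y - rdot (F t x) y| <= e / (2 * (P + 1)) * (nrm x * nrm y).
  by move=> s01 t01; rewrite lt_min => /andP[st _]; apply: osc; exact: hd1.
move=> /(_ hosc); rewrite -/P -/D rdot_opsum.
under eq_bigr do rewrite -rdotZl.
move=> /le_trans; apply.
have -> : P * (e / (2 * (P + 1)) * (nrm x * nrm y)) + c * (nrm x * nrm y) * d * D =
   (P * (e / (2 * (P + 1))) + d * (c * D)) * (nrm x * nrm y) by ring.
rewrite ler_wpM2r// [leRHS]splitr; apply: lerD.
  have -> : P * (e / (2 * (P + 1))) = e / 2 * (P / (P + 1)).
    by field; rewrite gt_eqF// ltr_wpDl.
  by rewrite ler_piMr ?divr_ge0 ?(ltW e0)// ler_pdivrMr ?ltr_wpDl// mul1r lerDl.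
apply: (@le_trans _ _ (d2 * (c * D + 1))).
  apply: ler_pM => //; [exact: mulr_ge0|by rewrite ge_min lexx orbT|by rewrite lerDl].
by rewrite /d2 le_eqVlt; apply/orP; left; apply/eqP; field; rewrite gt_eqF.
Qed.

(** All fine sums are close to the same scalar integrals, hence to one another in norm by
    [nrm_le_rdot]. The uniform midpoint sums provide the limit, and the others are compared with
    them. *)
Lemma op_integralP : is_op_integral G (op_integral G).
Proof.
apply: getPex.
have cauchy e : 0 < e -> exists2 d, 0 < d & forall l l' xi xi',
    itv_partition 0 1 l -> tagged d 0 l xi ->
    itv_partition 0 1 l' -> tagged d 0 l' xi' -> opb (opsum l xi G - opsum l' xi' G) e.
  move=> e0; have [d d0 hd] := opsum_form_close (divr_gt0 e0 (ltr0n _ 2)).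
  exists d => // l l' xi xi' pl tl pl' tl' x.
  apply: nrm_le_rdot; first by rewrite mulr_ge0 ?nrm_ge0// ltW.
  move=> y; rewrite -[(_ - _) x]/(opsum l xi G x - opsum l' xi' G x) rdotBl.
  have := hd l xi pl tl x y; have := hd l' xi' pl' tl' x y.
  set J := \int[_]_(_ in _) _; move: (rdot _ _) (rdot _ _) J => u v J.
  rewrite -(mulrA e (nrm x)); move: (nrm x * nrm y) => w; rewrite !ler_norml => /andP[h1 h2] /andP[h3 h4].
  by lra.
have bS n : bounded_op (opsum (upart n) (utag n) G).
  apply: (@bounded_opsum (n.+1%:R^-1 + 1)); first exact: upart_partition.
  by apply: tagged_upart; rewrite ltrDl.
have [|X [bX hX]] := bop_complete bS.
  move=> e e0; have [d d0 hd] := cauchy e e0; have [N hN] := invn_small d0.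
  exists N => m n Nm Nn; apply: hd; try exact: upart_partition.
    by apply: tagged_upart; exact: hN.
  by apply: tagged_upart; exact: hN.
exists X; split=> // e e0.
have e40 : 0 < e / 4 by rewrite divr_gt0.
have [d d0 hd] := cauchy _ e40; exists d => // l xi pl tg.
have [N hN] := invn_small d0; have [N' hN'] := hX _ e40.
pose n := maxn N N'.
have : opb (opsum l xi G - X) (e / 4 + e / 4).
  rewrite -(subrKA (opsum (upart n) (utag n) G)); apply: opbD.
    apply: hd => //; first exact: upart_partition.
    by apply: tagged_upart; rewrite hN// leq_maxl.
  by apply: hN'; rewrite leq_maxr.
move=> /opnorm_le => /(_ _)/le_lt_trans; apply; lra.
Qed.

Lemma opsum_op_integral e : 0 < e -> exists N, forall n, (N <= n)%N ->
  opb (opsum (upart n) (utag n) G - op_integral G) e.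
Proof.
move=> e0; have [bX /(_ e e0)[d d0 hd]] := op_integralP.
have [N hN] := invn_small d0; exists N => n Nn.
have tg := tagged_upart (hN n Nn).
apply: (@opb_le _ _ _ (opnorm (opsum (upart n) (utag n) G - op_integral G))).
  by apply: ltW; apply: hd => //; exact: upart_partition.
apply: opb_opnorm; apply: bopB => //; apply: bounded_opsum tg.
exact: upart_partition.
Qed.

Lemma op_integral_selfadjoint : (forall t, 0 <= t <= 1 -> selfadjoint (F t)) ->
  selfadjoint (op_integral G).
Proof.
move=> sF; apply: selfadjoint_limit => [|e /opsum_op_integral[N hN]].
  by case: op_integralP.
exists (opsum (upart N) (utag N) G); last exact: hN.
have tg : tagged (N.+1%:R^-1 + 1) 0 (upart N) (utag N).
  by apply: tagged_upart; rewrite ltrDl.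
apply: selfadjoint_sum => k; apply: selfadjointZ; apply/selfadjointZ/sF.
exact: (tag01 (upart_partition N) tg).
Qed.

Definition midmean n (g : R -> R) : R := \sum_(k < n.+1) n.+1%:R^-1 * g (utag n k).

Lemma midmean_op_integral x :
  midmean n (fun t => p t * rdot (F t x) x) @[n --> \oo] --> rdot (op_integral G x) x.
Proof.
apply/cvgrPdist_le => e e0.
have m0 : 0 < nrm x ^+ 2 + 1 by rewrite ltr_wpDl// sqr_ge0.
have [N hN] := opsum_op_integral (divr_gt0 e0 m0); exists N => // n /= Nn.
have -> : midmean n (fun t => p t * rdot (F t x) x) = rdot (opsum (upart n) (utag n) G x) x.
  rewrite opsum_upart op_sumE rdot_suml; apply: eq_bigr => k _.
  by rewrite -[(_ *: G _) x]/(_ *: (_ *: F _ x)) !rdotZl.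
rewrite distrC -rdotBl; apply: le_trans (normr_rdot_le _ _) _.
apply: (@le_trans _ _ (e / (nrm x ^+ 2 + 1) * nrm x * nrm x)).
  by rewrite ler_wpM2r ?nrm_ge0//; exact: (hN n Nn x).
rewrite -mulrA -expr2 mulrAC ler_pdivrMr// ler_wpM2l ?(ltW e0)//.
by rewrite lerDl.
Qed.

End OperatorIntegral.

(** * Midpoint averages of the weight converge to its Lebesgue integral *)

Section ScalarIntegral.
Context {R : realType}.
Variable p : R -> R.
Hypothesis psym : forall t : R, 0 <= t <= 1 -> p (1 - t) = p t.
Hypothesis pmono : forall s t : R, 0 <= s -> s <= t -> t <= 1 / 2 -> p s <= p t.

(** This is [p_riemann] with [h] constant, where only the variation term survives. *)
Lemma midmean_Rintegral :
  midmean n p @[n --> \oo] --> \int[lebesgue_measure]_(t in `[0, 1]) p t.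
Proof.
pose D := variation p 1 - variation p 0.
have D0 : 0 <= D by rewrite subr_ge0; apply: variation_homo.
apply/cvgrPdist_le => e e0.
have d0 : 0 < e / (D + 1) by rewrite divr_gt0// ltr_wpDl.
have [N hN] := invn_small d0; exists N => // n /= Nn.
have := @p_riemann _ p psym pmono (cst 1) 1 0 (e / (D + 1)) (upart n) (utag n).
move=> /(_ _ ler01 (lexx _) _ (ltW d0) _ (upart_partition n) (tagged_upart (hN n Nn))).
rewrite mulr0 add0r mul1r -/D.
rewrite (_ : \int[_]_(_ in _) _ = \int[lebesgue_measure]_(t in `[0, 1]) p t); last first.
  by apply: eq_Rintegral => t _; rewrite mulr1.
have -> : \sum_(k < size (@upart R n)) (nth 0 (upart n) k - nth 0 (0 :: upart n) k) *
    (p (utag n k) * cst 1 (@utag R n k)) = midmean n p.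
  rewrite (sum_upart n (fun k => p (utag n k) * cst 1 (utag n k))).
  by apply: eq_bigr => k _; rewrite mulr1.
rewrite distrC => h; apply: le_trans (h _ _ _) _.
- by move=> t _; rewrite normr1.
- by move=> t; exact: cvg_cst.
- by move=> s t _ _ _; rewrite subrr normr0.
- by rewrite mulrAC ler_pdivrMr ?ltr_wpDl// ler_wpM2l ?(ltW e0)// lerDl.
Qed.

End ScalarIntegral.

(** * Scalar inequalities for midpoint averages *)

Section MidpointMean.
Context {R : realType}.
Implicit Types (g h : R -> R) (n m k : nat) (a b s t : R).

Lemma utag_itv n k : (k < n.+1)%N -> 0 < (utag n k : R) < 1.
Proof.
move=> kn; have : k.+1%:R <= n.+1%:R :> R by rewrite ler_nat.
rewrite -[k.+1%:R]natr1 => kn'; have k0 : 0 <= k%:R :> R by [].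
rewrite /utag; apply/andP; split; first by apply: divr_gt0 => //; lra.
by rewrite ltr_pdivrMr// mul1r; lra.
Qed.

Lemma midmean_le n g h : (forall t, 0 < t < 1 -> g t <= h t) -> midmean n g <= midmean n h.
Proof.
move=> gh; apply: ler_sum => k _; rewrite ler_wpM2l// gh//.
exact: utag_itv.
Qed.

Lemma eq_midmean n g h : (forall t, 0 < t < 1 -> g t = h t) -> midmean n g = midmean n h.
Proof.
by move=> gh; apply: le_anti; rewrite !midmean_le// => t /gh ->.
Qed.

Lemma midmeanD n g h : midmean n (fun t => g t + h t) = midmean n g + midmean n h.
Proof. by rewrite /midmean -big_split/=; apply: eq_bigr => k _; rewrite mulrDr. Qed.

Lemma midmeanZ n a g : midmean n (fun t => a * g t) = a * midmean n g.
Proof. by rewrite /midmean mulr_sumr; apply: eq_bigr => k _; rewrite mulrCA. Qed.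

Lemma midmean_cst n a : midmean n (fun=> a) = a :> R.
Proof.
rewrite /midmean sumr_const card_ord -mulrnAl -[_ *+ n.+1]mulr_natr mulVf//.
by rewrite mul1r.
Qed.

Lemma midmean_rev n g : midmean n (fun t => g (1 - t)) = midmean n g.
Proof.
rewrite /midmean (reindex_inj rev_ord_inj)/=; apply: eq_bigr => k _.
congr (_ * g _); rewrite /utag subSS natrB; last by rewrite -ltnS.
by rewrite -[n.+1%:R]natr1; field; rewrite natr1.
Qed.

(** Since min(t, 1 - t) = 1/2 - |t - 1/2|, this is the function w of the overview; in this form it
    is the distance to 1/4 after folding [0, 1] onto [0, 1/2]. *)
Definition zigzag t : R := `|Num.min t (1 - t) - 1 / 4|.

(* The first and the second quarter of the subdivision add up termwise to 1/4. *)
Lemma midmean_zigzag m : midmean (4 * m.+1).-1 zigzag = 1 / 8.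
Proof.
set N := (4 * m.+1)%N; have N0 : (0 < N)%N by rewrite muln_gt0.
pose M : R := m.+1%:R; have M0 : 0 < M by rewrite ltr0n.
have NE : N%:R = 4 * M by rewrite natrM.
pose u (k : nat) : R := (k%:R + 1 / 2) / (4 * M).
have -> : midmean N.-1 zigzag = (4 * M)^-1 * \sum_(0 <= k < N) zigzag (u k).
  rewrite /midmean prednK// -mulr_sumr NE big_mkord; congr (_ * _).
  by apply: eq_bigr => k _; rewrite /utag prednK// NE.
have small k : (k < m.+1)%N -> 0 <= u k <= 1 / 4.
  move=> km; have h : (k%:R : R) + 1 <= M by rewrite natr1 ler_nat.
  have k0 : 0 <= (k%:R : R) by [].
  by rewrite /u divr_ge0 ?addr_ge0 ?mulr_ge0 ?(ltW M0)//= ler_pdivrMr ?mulr_gt0//; lra.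
have shift j k : u (j * m.+1 + k)%N = j%:R / 4 + u k.
  by rewrite /u natrD natrM -/M; field; rewrite gt_eqF.
have -> : \sum_(0 <= k < N) zigzag (u k) =
    \sum_(0 <= k < m.+1) (zigzag (u k) + zigzag (1 / 4 + u k) +
      (zigzag (2 / 4 + u k) + zigzag (3 / 4 + u k))).
  have blk j : \sum_(j * m.+1 <= k < j.+1 * m.+1) zigzag (u k) =
      \sum_(0 <= k < m.+1) zigzag (j%:R / 4 + u k).
    rewrite -{1}[(j * m.+1)%N]add0n mulSn big_addn addnK.
    by apply: eq_bigr => k _; rewrite addnC shift.
  rewrite (big_cat_nat (n := (1 * m.+1)%N))//=; last by rewrite leq_mul2r.
  rewrite (big_cat_nat (m := (1 * m.+1)%N) (n := (2 * m.+1)%N))//=; try by rewrite leq_mul2r.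
  rewrite (big_cat_nat (m := (2 * m.+1)%N) (n := (3 * m.+1)%N))//=; try by rewrite leq_mul2r.
  have := blk 0%N; rewrite mul0n => ->; rewrite !blk -!big_split/=.
  by apply: eq_bigr => k _; rewrite mul0r add0r !addrA.
rewrite (eq_big_nat _ _ (F2 := fun=> 1 / 2)).
  rewrite sumr_const_nat subn0 -[_ *+ _]mulr_natr -/M.
  by field; rewrite gt_eqF.
move=> k /andP[_ /small /andP[u0 u1]]; rewrite /zigzag.
rewrite (min_idPl (_ : u k <= _)); last lra.
rewrite (min_idPl (_ : 1 / 4 + u k <= _)); last lra.
rewrite (min_idPr (_ : _ <= 2 / 4 + u k)); last lra.
rewrite (min_idPr (_ : _ <= 3 / 4 + u k)); last lra.
rewrite (@ler0_norm _ (u k - _)); last lra.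
rewrite (@ger0_norm _ (1 / 4 + u k - _)); last lra.
rewrite (@ger0_norm _ (1 - (2 / 4 + u k) - _)); last lra.
rewrite (@ler0_norm _ (1 - (3 / 4 + u k) - _)); last lra.
by lra.
Qed.

Lemma midmean_osc n g a b : (forall t, 0 < t < 1 -> a <= g t <= b) ->
  forall t, 0 < t < 1 -> `|midmean n g - g t| <= b - a.
Proof.
move=> hg t /hg /andP[h1 h2].
have : midmean n g <= b.
  by rewrite -(midmean_cst n b); apply: midmean_le => s /hg /andP[].
have : a <= midmean n g.
  by rewrite -(midmean_cst n a); apply: midmean_le => s /hg /andP[].
by move=> h3 h4; rewrite ler_norml; apply/andP; split; lra.
Qed.

(** Any constant [c] may be subtracted from [h], because the mean of [g] minus [g] averages to 0. *)
Lemma midmean_cov_le m g h a b c : 0 <= a -> 0 <= b ->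
  (forall t, 0 < t < 1 -> `|midmean (4 * m.+1).-1 g - g t| <= a) ->
  (forall t, 0 < t < 1 -> `|h t - c| <= b * zigzag t) ->
  midmean (4 * m.+1).-1 g * midmean (4 * m.+1).-1 h -
    midmean (4 * m.+1).-1 (fun t => g t * h t) <= a * b / 8.
Proof.
move=> a0 b0 hg hh; set E := midmean (4 * m.+1).-1 in hg *.
have -> : E g * E h - E (fun t => g t * h t) = E (fun t => (E g - g t) * (h t - c)).
  transitivity (E (fun t => E g * h t + (-1 * (g t * h t) + (- c * E g + c * g t)))).
    rewrite /E !midmeanD !midmeanZ midmean_cst; ring.
  by apply: eq_midmean => t _; ring.
have <- : E (fun t => a * b * zigzag t) = a * b / 8.
  by rewrite /E midmeanZ midmean_zigzag; field.
apply: midmean_le => t t01; apply: le_trans (ler_norm _) _.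
by rewrite normrM -mulrA ler_pM// ?hg ?hh.
Qed.

(* Korkine's identity: twice the covariance is the double mean of
   (g t - g s) * (h s - h t). *)
Lemma midmean_cov_ge0 n g h :
  (forall s t, 0 < s < 1 -> 0 < t < 1 -> 0 <= (g t - g s) * (h s - h t)) ->
  0 <= midmean n g * midmean n h - midmean n (fun t => g t * h t).
Proof.
move=> gh; set E := midmean n.
have : 0 <= E (fun s => E (fun t => (g t - g s) * (h s - h t))).
  rewrite -(midmean_cst n 0); apply: midmean_le => s s01.
  by rewrite -(midmean_cst n 0); apply: midmean_le => t t01; exact: gh.
have -> : E (fun s => E (fun t => (g t - g s) * (h s - h t))) =
    2 * (E g * E h - E (fun t => g t * h t)).
  transitivity (E (fun s => E g * h s + (- E (fun t => g t * h t) +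
      (-1 * (g s * h s) + E h * g s)))).
    apply: eq_midmean => s _.
    transitivity (E (fun t => h s * g t + (-1 * (g t * h t) + (- (g s * h s) + g s * h t)))).
      by apply: eq_midmean => t _; ring.
    by rewrite /E !midmeanD !midmeanZ midmean_cst; ring.
  by rewrite /E !midmeanD !midmeanZ midmean_cst; ring.
by rewrite pmulr_rge0.
Qed.

End MidpointMean.

(** * Covariance of a symmetric monotone weight with a convex function *)

Section ConvexScalar.
Context {R : realType}.
Implicit Types (s t l K L : R) (n m : nat).
Variables (p phi : R -> R).
Hypothesis psym : forall t : R, 0 <= t <= 1 -> p (1 - t) = p t.
Hypothesis pmono : forall s t : R, 0 <= s -> s <= t -> t <= 1 / 2 -> p s <= p t.
Hypothesis cphi : forall s t l, 0 <= s <= 1 -> 0 <= t <= 1 -> 0 <= l <= 1 ->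
  phi ((1 - l) * s + l * t) <= (1 - l) * phi s + l * phi t.

Definition symmetrized t := (phi t + phi (1 - t)) / 2.
Local Notation psi := symmetrized.

Lemma symmetrizedC t : psi (1 - t) = psi t.
Proof. by rewrite /symmetrized subKr [phi (1 - t) + _]addrC. Qed.

Lemma symmetrized_convex s t l : 0 <= s <= 1 -> 0 <= t <= 1 -> 0 <= l <= 1 ->
  psi ((1 - l) * s + l * t) <= (1 - l) * psi s + l * psi t.
Proof.
move=> s01 t01 l01; rewrite /symmetrized.
have := cphi s01 t01 l01.
have s01' : 0 <= 1 - s <= 1 by lra.
have t01' : 0 <= 1 - t <= 1 by lra.
have := cphi s01' t01' l01.
rewrite (_ : (1 - l) * (1 - s) + l * (1 - t) = 1 - ((1 - l) * s + l * t)); last by ring.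
by move: (phi _) (phi (_ + _)) => u v; lra.
Qed.

(** t lies between s and 1 - s, where psi takes equal values, so convexity puts psi(t) below
    them. *)
Lemma symmetrized_antitone s t : 0 <= s -> s <= t -> t <= 1 / 2 -> psi t <= psi s.
Proof.
move=> s0 st t1; have [sh|sh] := eqVneq s (1 / 2).
  by have -> : t = s by apply: le_anti; rewrite st sh t1.
have s1 : s < 1 / 2 by rewrite lt_neqAle sh (le_trans st).
have d0 : 0 < 1 - 2 * s by lra.
have l01 : 0 <= (t - s) / (1 - 2 * s) <= 1.
  apply/andP; split; first by apply: divr_ge0; lra.
  by rewrite ler_pdivrMr// mul1r; lra.
have s01 : 0 <= s <= 1 by lra.
have s01' : 0 <= 1 - s <= 1 by lra.
have := symmetrized_convex s01 s01' l01.
rewrite symmetrizedC (_ : _ * s + _ * (1 - s) = t); last by field; rewrite gt_eqF.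
by lra.
Qed.

Lemma min_half t : 0 <= t <= 1 -> 0 <= Num.min t (1 - t) <= 1 / 2.
Proof. by move=> /andP[t0 t1]; case: (leP t (1 - t)) => h; lra. Qed.

Lemma fold_p t : 0 <= t <= 1 -> p (Num.min t (1 - t)) = p t.
Proof. by move=> t01; case: leP => // _; exact: psym. Qed.

Lemma fold_psi t : psi (Num.min t (1 - t)) = psi t.
Proof. by case: leP => // _; exact: symmetrizedC. Qed.

Lemma midmean_symmetrized n : midmean n psi = midmean n phi.
Proof.
transitivity (midmean n (fun t => 1 / 2 * phi t + 1 / 2 * phi (1 - t))).
  by apply: eq_midmean => t _; rewrite /symmetrized; field.
by rewrite midmeanD !midmeanZ midmean_rev; field.
Qed.

Lemma midmean_pM_symmetrized n :
  midmean n (fun t => p t * psi t) = midmean n (fun t => p t * phi t).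
Proof.
transitivity (midmean n (fun t => 1 / 2 * (p t * phi t) + 1 / 2 * (p (1 - t) * phi (1 - t)))).
  apply: eq_midmean => t /andP[t0 t1]; rewrite psym; last by rewrite !ltW.
  by rewrite /symmetrized; field.
by rewrite midmeanD !midmeanZ (midmean_rev n (fun t => p t * phi t)); field.
Qed.

(** Folding by t -> min(t, 1 - t) brings both arguments into [0, 1/2], where [p] and psi are
    monotone in opposite senses, so every product in Korkine's identity is nonnegative. *)
Lemma midmean_fejer_ge0 n :
  0 <= midmean n p * midmean n phi - midmean n (fun t => p t * phi t).
Proof.
rewrite -midmean_symmetrized -midmean_pM_symmetrized; apply: midmean_cov_ge0 => s t.
move=> /andP[s0 s1] /andP[t0 t1].
have s01 : 0 <= s <= 1 by rewrite !ltW.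
have t01 : 0 <= t <= 1 by rewrite !ltW.
rewrite -(fold_p s01) -(fold_p t01) -(fold_psi s) -(fold_psi t).
have /andP[] := min_half s01; have /andP[] := min_half t01.
move: (Num.min s _) (Num.min t _) => u v v0 v1 u0 u1.
have [uv|/ltW vu] := leP u v.
  by rewrite mulr_ge0// subr_ge0; [exact: pmono|exact: symmetrized_antitone].
by rewrite mulr_le0// subr_le0; [exact: pmono|exact: symmetrized_antitone].
Qed.

Lemma symmetrized_bounds t : 0 <= t <= 1 -> psi (1 / 2) <= psi t <= psi 0.
Proof.
move=> t01; rewrite -(fold_psi t); have /andP[h1 h2] := min_half t01.
by apply/andP; split; exact: symmetrized_antitone.
Qed.

(** After folding, [zigzag t] is exactly the distance to 1/4. The Lipschitz hypothesis leaves out 0,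
    where the weight of (i) may jump. *)
Lemma quarter_lipschitz (q : R -> R) K t :
  (forall s t, 0 < s -> s <= t -> t <= 1 / 2 -> `|q s - q t| <= K * (t - s)) ->
  (forall t, 0 <= t <= 1 -> q (Num.min t (1 - t)) = q t) ->
  0 < t < 1 -> `|q t - q (1 / 4)| <= K * zigzag t.
Proof.
move=> hq qs /andP[t0 t1]; have t01 : 0 <= t <= 1 by rewrite !ltW.
rewrite -qs// /zigzag; have /andP[_ u1] := min_half t01.
have u0 : 0 < Num.min t (1 - t) by rewrite lt_min t0 subr_gt0.
move: (Num.min _ _) u0 u1 => u u0 u1; have [uq|/ltW qu] := leP u (1 / 4).
  rewrite (@ler0_norm _ (u - _)) ?subr_le0// opprB; apply: hq => //; lra.
rewrite distrC (@ger0_norm _ (u - _)) ?subr_ge0//; apply: hq => //; lra.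
Qed.

Lemma midmean_fejer_le_lipschitz m L : 0 <= L ->
  (forall s t, 0 < s < 1 -> 0 < t < 1 -> `|p s - p t| <= L * `|s - t|) ->
  midmean (4 * m.+1).-1 p * midmean (4 * m.+1).-1 phi
    - midmean (4 * m.+1).-1 (fun t => p t * phi t) <=
  1 / 8 * L * ((phi 0 + phi 1) / 2 - phi (1 / 2)).
Proof.
move=> L0 hL; rewrite -midmean_symmetrized -midmean_pM_symmetrized.
have E0 : psi 0 = (phi 0 + phi 1) / 2 by rewrite /symmetrized subr0.
have E1 : psi (1 / 2) = phi (1 / 2).
  by rewrite /symmetrized (_ : 1 - 1 / 2 = 1 / 2 :> R); field.
rewrite -E0 -E1.
have -> : 1 / 8 * L * (psi 0 - psi (1 / 2)) = (psi 0 - psi (1 / 2)) * L / 8 by field.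
(* Here psi contributes its oscillation psi(0) - psi(1/2) and [p] its Lipschitz constant. *)
rewrite [midmean _ p * _]mulrC.
rewrite (@eq_midmean _ _ (fun t => p t * psi t) (fun t => psi t * p t)); last by move=> t _; rewrite mulrC.
apply: (@midmean_cov_le _ _ _ _ _ _ (p (1 / 4))) => //.
- by rewrite subr_ge0; apply: symmetrized_antitone => //; lra.
- apply: midmean_osc => t /andP[t0 t1]; apply: symmetrized_bounds.
  by rewrite !ltW.
- move=> t; apply: quarter_lipschitz; last exact: fold_p.
  move=> s u s0 su u1; have [h1 h2] : 0 < s < 1 /\ 0 < u < 1 by split; lra.
  by apply: le_trans (hL _ _ h1 h2) _; rewrite distrC ger0_norm ?subr_ge0.
Qed.

(* a and b are lower bounds for the slopes of phi at 0 and of phi o (1 - .) at 0. *)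
Lemma midmean_fejer_le_slopes m a b :
  (forall t, 0 <= t <= 1 -> phi 0 + a * t <= phi t) ->
  (forall t, 0 <= t <= 1 -> phi 1 + b * t <= phi (1 - t)) ->
  midmean (4 * m.+1).-1 p * midmean (4 * m.+1).-1 phi
    - midmean (4 * m.+1).-1 (fun t => p t * phi t) <=
  1 / 16 * (p (1 / 2) - p 0) * (- a - b).
Proof.
move=> ha hb; rewrite -midmean_symmetrized -midmean_pM_symmetrized.
(* - K is the mean of the two slopes, a lower bound for the slope of psi at 0; halving here turns
   1/8 into 1/16. *)
pose K := (- a - b) / 2.
have hK t : 0 <= t <= 1 -> psi 0 - psi t <= K * t.
  move=> t01; rewrite /symmetrized subr0 /K; have := ha t t01; have := hb t t01; lra.
have K0 : 0 <= K.
  have h : 0 <= (1 / 2 : R) <= 1 by lra.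
  have := hK _ h; have := @symmetrized_antitone 0 (1 / 2) (lexx _); lra.
have -> : 1 / 16 * (p (1 / 2) - p 0) * (- a - b) = (p (1 / 2) - p 0) * K / 8.
  by rewrite /K; field.
apply: (@midmean_cov_le _ _ _ _ _ _ (psi (1 / 4))) => //.
- by rewrite subr_ge0; apply: pmono => //; lra.
- apply: midmean_osc => t /andP[t0 t1]; apply: p_bounds => //.
  by rewrite !ltW.
- move=> t; apply: quarter_lipschitz; last by move=> s _; exact: fold_psi.
  move=> s u s0 su u1; rewrite ger0_norm; last first.
    by rewrite subr_ge0 symmetrized_antitone// ltW.
  have u0 : 0 < u by rewrite (lt_le_trans s0).
  have l01 : 0 <= s / u <= 1.
    apply/andP; split; first by rewrite divr_ge0// ltW.
    by rewrite ler_pdivrMr// mul1r.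
  have z01 : 0 <= (0 : R) <= 1 by rewrite lexx ler01.
  have u01 : 0 <= u <= 1 by lra.
  (* Convexity propagates the bound from 0 to the right: psi(s) - psi(u) <= (1 - s / u) (psi(0) -
     psi(u)) <= K (u - s). *)
  have := symmetrized_convex z01 u01 l01; rewrite mulr0 add0r divfK ?gt_eqF// => h1.
  have h2 := hK u u01.
  have : (1 - s / u) * (psi 0 - psi u) <= (1 - s / u) * (K * u).
    by rewrite ler_wpM2l// subr_ge0; case/andP: l01.
  have -> : (1 - s / u) * (K * u) = K * (u - s) by field; rewrite gt_eqF.
  by move: (psi s) (psi u) (psi 0) (s / u) h1 => *; lra.
Qed.

End ConvexScalar.

(** * Gateaux derivatives *)

Section Gateaux.
Context {R : realType} {H : hilbertType R}.
Implicit Types (x y : H) (a c d e s t : R) (A B S T L : H -> H) (I : interval R)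
  (g : (H -> H) -> H -> H).

Definition diff_quotient g T S s : H -> H := s^-1%:C *: (g (T + s%:C *: S) - g T).

Lemma gateaux_near I g T S L x e : is_gateaux I g T S L -> 0 < e ->
  exists2 d, 0 < d & forall s, s != 0 -> `|s| < d -> SA I (T + s%:C *: S) ->
    nrm (diff_quotient g T S s x - L x) < e.
Proof.
move=> [_ /(_ x)/cvgHP hL] /hL; rewrite near_withinE => -[d /= d0 hd].
exists d => // s s0 sd sI; apply: hd => //=.
by rewrite sub0r normrN.
Qed.

(** Difference quotients of symmetric values are symmetric, and strong limits preserve this.
    Admissible steps arbitrarily close to 0 are assumed, because otherwise the limit in [is_gateaux]
    says nothing about [L]. *)
Lemma gateaux_symop I g T S L : is_gateaux I g T S L -> symop (g T) ->
  (forall d, 0 < d -> exists s, [/\ s != 0, `|s| < d, SA I (T + s%:C *: S) &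
    symop (g (T + s%:C *: S))]) -> symop L.
Proof.
move=> hL sT acc x y; apply/eqP; rewrite -subr_eq0 -normr_le0.
apply/ler_addgt0Pr => e e0; rewrite add0r.
pose m := nrm x + nrm y + 1.
have m0 : 0 < m by rewrite ltr_wpDl// addr_ge0 ?nrm_ge0.
have em0 : 0 < e / m by rewrite divr_gt0.
have [d1 d10 h1] := gateaux_near x hL em0.
have [d2 d20 h2] := gateaux_near y hL em0.
have [|s [s0 sd sI sg]] := acc (Num.min d1 d2); first by rewrite lt_min d10.
move: sd; rewrite lt_min => /andP[sd1 sd2].
have {h1} := h1 s s0 sd1 sI; have {h2} := h2 s s0 sd2 sI.
set Q := diff_quotient g T S s => h2 h1.
have sQ : rdot (Q x) y = rdot x (Q y).
  rewrite /Q -[diff_quotient _ _ _ _ x]/(_ *: (_ x - _ x)) rdotZl.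
  rewrite -[diff_quotient _ _ _ _ y]/(_ *: (_ y - _ y)) rdotZr.
  by rewrite rdotBl rdotBr sg sT.
have -> : rdot (L x) y - rdot x (L y) = rdot x (Q y - L y) - rdot (Q x - L x) y.
  by rewrite rdotBr rdotBl sQ; ring.
apply: le_trans (ler_normB _ _) _.
apply: le_trans (lerD (normr_rdot_le _ _) (normr_rdot_le _ _)) _.
apply: (@le_trans _ _ (nrm x * (e / m) + e / m * nrm y)).
  by apply: lerD; [rewrite ler_wpM2l|rewrite ler_wpM2r]; rewrite ?nrm_ge0// ltW.
rewrite [nrm x * _]mulrC -mulrDr mulrAC ler_pdivrMr// ler_wpM2l ?(ltW e0)//.
by rewrite /m lerDl.
Qed.

(* By convexity the difference quotients of phi at 0 decrease to the limit given by L,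
   which is therefore a lower bound for all of them. *)
Lemma gateaux_slope I g T S L x c (phi : R -> R) : is_gateaux I g T S L -> `|c| = 1 ->
  (forall t, 0 <= t <= 1 -> SA I (T + (c * t)%:C *: S)) ->
  (forall t, 0 <= t <= 1 -> rdot (g (T + (c * t)%:C *: S) x) x = phi t) ->
  (forall t l, 0 <= t <= 1 -> 0 <= l <= 1 -> phi (l * t) <= (1 - l) * phi 0 + l * phi t) ->
  forall t, 0 <= t <= 1 -> phi 0 + c * rdot (L x) x * t <= phi t.
Proof.
move=> hL c1 hI hphi cphi t /[dup] t01 /andP[t0 t1].
have [->|tn0] := eqVneq t 0; first by rewrite mulr0 addr0.
have {}t0 : 0 < t by rewrite lt_neqAle eq_sym tn0.
have cc : c * c = 1 by rewrite -expr2 -real_normK ?num_real// c1 expr1n.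
have cn0 : c != 0 by rewrite -normr_eq0 c1 oner_eq0.
apply/ler_addgt0Pr => e e0.
have m0 : 0 < nrm x + 1 by rewrite ltr_wpDl// nrm_ge0.
have [d d0 hd] := gateaux_near x hL (divr_gt0 e0 m0).
(* Below [d] the quotient at [s] is close to [L]; below [t] it is bounded by the quotient at [t]. *)
pose s := Num.min t (d / 2).
have s0 : 0 < s by rewrite lt_min t0 divr_gt0.
have st : s <= t by rewrite ge_min lexx.
have sd : s < d.
  apply: (@le_lt_trans _ _ (d / 2)); first by rewrite ge_min lexx orbT.
  by rewrite ltr_pdivrMr// ltr_pMr// ltr1n.
have s01 : 0 <= s <= 1 by rewrite ltW//= (le_trans st).
have cs0 : c * s != 0 by rewrite mulf_neq0// gt_eqF.
have csd : `|c * s| < d by rewrite normrM c1 mul1r gtr0_norm.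
have hq := hd (c * s) cs0 csd (hI s s01).
have gT : rdot (g T x) x = phi 0.
  have z01 : 0 <= (0 : R) <= 1 by rewrite lexx ler01.
  by rewrite -hphi// mulr0 scale0r addr0.
have Q : rdot (diff_quotient g T S (c * s) x) x = c * ((phi s - phi 0) / s).
  rewrite -[diff_quotient _ _ _ _ x]/(_ *: (_ x - _ x)) rdotZl rdotBl hphi// gT.
  have -> : (c * s)^-1 = c / s.
    by rewrite invfM; congr (_ * _); apply: (mulfI cn0); rewrite divff// cc.
  by rewrite mulrAC mulrA.
have : `|rdot (diff_quotient g T S (c * s) x - L x) x| <= e.
  apply: le_trans (normr_rdot_le _ _) _.
  apply: (@le_trans _ _ (e / (nrm x + 1) * nrm x)).
    by rewrite ler_wpM2r ?nrm_ge0// ltW.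
  by rewrite mulrAC ler_pdivrMr// ler_wpM2l ?(ltW e0)// lerDl.
rewrite rdotBl Q.
have -> : c * ((phi s - phi 0) / s) - rdot (L x) x =
    c * ((phi s - phi 0) / s - c * rdot (L x) x) by rewrite mulrBr (mulrA c c) cc mul1r.
rewrite normrM c1 mul1r ler_norml => /andP[+ _].
have l01 : 0 <= s / t <= 1.
  by apply/andP; split; [rewrite divr_ge0// ltW|rewrite ler_pdivrMr// mul1r].
have := cphi t _ t01 l01; rewrite divfK// => h1.
have h2 : (phi s - phi 0) / s <= (phi t - phi 0) / t.
  rewrite ler_pdivrMr// mulrAC -[leRHS]mulrA.
  by rewrite (_ : (phi t - phi 0) * (s / t) = s / t * (phi t - phi 0)) 1?mulrC//; lra.
move=> h3; set r := c * rdot (L x) x in h3 *.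
have : r - e <= (phi t - phi 0) / t by lra.
rewrite ler_pdivlMr// mulrBl => h4.
have : e * t <= e by rewrite ler_piMr// ltW.
by lra.
Qed.

End Gateaux.

Lemma derive_lipschitz (R : realType) (p : R -> R) (a b L : R) :
  (forall t, a < t < b -> derivable p t 1) ->
  (forall t, a < t < b -> `|derive1 p t| <= L) ->
  forall s t, a < s < b -> a < t < b -> `|p s - p t| <= L * `|s - t|.
Proof.
move=> dp hL s t; wlog st : s t / s < t => [hw hs ht|/andP[as_ sb] /andP[at_ tb]].
  have [st|ts|->] := ltgtP s t; first exact: hw.
    by rewrite distrC (distrC s); exact: hw.
  by rewrite !subrr normr0 mulr0.
have ab u : s <= u <= t -> a < u < b.
  by move=> /andP[su ut]; rewrite (lt_le_trans as_)//= (le_lt_trans ut).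
have [u||c] := @MVT R p (derive1 p) s t st.
- rewrite in_itv/= => /andP[su ut]; rewrite derive1E; apply: DeriveDef => //.
  by apply/dp/ab; rewrite !ltW.
- apply: derivable_within_continuous => u; rewrite in_itv/= => /ab; exact: dp.
move=> /[!in_itv]/= /andP[sc ct] E.
rewrite distrC E (distrC s) normrM ler_wpM2r//; apply/hL/ab.
by rewrite !ltW.
Qed.

(** * The operator inequalities *)

Section OperatorFejer.
Context {R : realType} {H : hilbertType R}.
Variables (I : interval R) (f p : R -> R) (A B : H -> H).
Hypothesis hf : operator_convex I f.
Hypotheses (hA : SA I A) (hB : SA I B).
Hypothesis psym : forall t : R, 0 <= t <= 1 -> p (1 - t) = p t.
Hypothesis pmono : forall s t : R, 0 <= s -> s <= t -> t <= 1 / 2 -> p s <= p t.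
Implicit Types (s t l : R) (x : H).

Let T t : H -> H := t%:C *: A + (1 - t)%:C *: B.
Let F t : H -> H := cfc f (T t).
Let D : H -> H :=
  (\int[lebesgue_measure]_(t in `[0, 1]) p t)%:C *: op_integral F
  - op_integral (fun t => (p t)%:C *: F t).
Let phi x t := rdot (F t x) x.

(** This settles the zero space, where the spectral arguments have no vector to start from. *)
Lemma op_le_trivial (S S' : H -> H) : ~ (exists x : H, x != 0) -> op_le S S'.
Proof.
move=> h x; have -> : x = 0 by apply/eqP; apply: contrapT => /negP x0; apply: h; exists x.
by rewrite !linear0r.
Qed.

Lemma segment_comb s t l : (1 - l)%:C *: T s + l%:C *: T t = T ((1 - l) * s + l * t).
Proof.
rewrite /T !scalerDr !scalerA -!rmorphM addrACA -!scalerDl -!rmorphD.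
by congr (_%:C *: _ + _%:C *: _); ring.
Qed.

Lemma segment0 : T 0 = B.
Proof. by rewrite /T scale0r add0r subr0 scale1r. Qed.

Lemma segment1 : T 1 = A.
Proof. by rewrite /T subrr scale0r addr0 scale1r. Qed.

Lemma segment_half : T (1 / 2) = (1 / 2)%:C *: (A + B).
Proof. by rewrite scalerDr /T (_ : 1 - 1 / 2 = 1 / 2 :> R)//; field. Qed.

(** [T] starts at [B], so entering the segment means moving along B - A backwards from [B] and
    forwards from [A]: these are the signs -1 and 1 expected by [gateaux_slope]. *)
Lemma segment_from_B t : B + (-1 * t)%:C *: (B - A) = T t.
Proof.
rewrite mulN1r rmorphN scaleNr scalerBr opprB /T rmorphB/= scalerBl scale1r.
by rewrite addrCA.
Qed.

Lemma segment_from_A t : A + (1 * t)%:C *: (B - A) = T (1 - t).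
Proof.
rewrite mul1r scalerBr /T subKr rmorphB/= scalerBl scale1r.
by rewrite addrCA addrC.
Qed.

Hypothesis Hn : exists x : H, x != 0.

Lemma segment_SA t : 0 <= t <= 1 -> SA I (T t).
Proof. by move=> t01; have [m [M [_ _ /(_ t t01)[]]]] := SA_segment hA hB Hn. Qed.

Lemma segment_selfadjoint t : 0 <= t <= 1 -> selfadjoint (F t).
Proof. by have [sF _ _] := cfc_segment hf.1 hA hB Hn; exact: sF. Qed.

Lemma phi_convex x s t l : 0 <= s <= 1 -> 0 <= t <= 1 -> 0 <= l <= 1 ->
  phi x ((1 - l) * s + l * t) <= (1 - l) * phi x s + l * phi x t.
Proof.
move=> s01 t01 l01.
have := hf.2 H (T s) (T t) l (segment_SA s01) (segment_SA t01) l01 x.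
rewrite segment_comb lecE => /andP[_ h].
have : rdot (F ((1 - l) * s + l * t) x) x <=
  rdot ((1 - l)%:C *: F s x + l%:C *: F t x) x := h.
by rewrite rdotDl !rdotZl.
Qed.

(** The unweighted integral of [F] is treated as a weighted one with constant weight, so the same
    existence and limit results cover both. *)
Let one (t : R) : R := 1.

Let one_sym t : 0 <= t <= 1 -> one (1 - t) = one t.
Proof. by []. Qed.

Let one_mono s t : 0 <= s -> s <= t -> t <= 1 / 2 -> one s <= one t.
Proof. by []. Qed.

Let F1E : op_integral F = op_integral (fun t => (one t)%:C *: F t).
Proof. by congr op_integral; apply/funext => t; rewrite scale1r. Qed.

Lemma fejer_selfadjoint : selfadjoint D.
Proof.
have [sF [c c0 hc] cF] := cfc_segment hf.1 hA hB Hn.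
have bF t : 0 <= t <= 1 -> bounded_op (F t) by move=> /sF; exact: selfadjoint_bop.
rewrite /D F1E; apply: selfadjointB; first apply: selfadjointZ.
  exact: (op_integral_selfadjoint one_sym one_mono bF c0 hc cF sF).
exact: (op_integral_selfadjoint psym pmono bF c0 hc cF sF).
Qed.

Lemma fejer_limit x :
  midmean n p * midmean n (phi x) - midmean n (fun t => p t * phi x t)
    @[n --> \oo] --> rdot (D x) x.
Proof.
have [sF [c c0 hc] cF] := cfc_segment hf.1 hA hB Hn.
have bF t : 0 <= t <= 1 -> bounded_op (F t) by move=> /sF; exact: selfadjoint_bop.
have -> : rdot (D x) x = (\int[lebesgue_measure]_(t in `[0, 1]) p t) *
    rdot (op_integral F x) x - rdot (op_integral (fun t => (p t)%:C *: F t) x) x.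
  by rewrite -rdotZl -rdotBl.
apply: cvgB; last exact: (midmean_op_integral psym pmono bF c0 hc cF).
apply: cvgM; first exact: midmean_Rintegral.
have := midmean_op_integral (x := x) one_sym one_mono bF c0 hc cF; rewrite -F1E.
rewrite (_ : (fun n => _) = (fun n => midmean n (phi x)))//.
by apply/funext => n; apply: eq_midmean => t _; rewrite mul1r.
Qed.

Lemma fejer_ge0 x : 0 <= rdot (D x) x.
Proof.
have h := @fejer_limit x; rewrite -(cvg_lim _ h)//; apply: limr_ge.
  by apply/cvg_ex; eexists; exact: h.
by near=> n; apply: midmean_fejer_ge0 => // s t l; exact: phi_convex.
Unshelve. all: by end_near. Qed.

(** A bound along the subsequence of multiples of 4 suffices, the whole sequence being convergent by
    [fejer_limit]. *)
Lemma fejer_le x c :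
  (forall m, midmean (4 * m.+1).-1 p * midmean (4 * m.+1).-1 (phi x)
    - midmean (4 * m.+1).-1 (fun t => p t * phi x t) <= c) -> rdot (D x) x <= c.
Proof.
move=> hc; apply/ler_addgt0Pr => e e0.
have /cvgrPdist_le/(_ e e0)[N _ hN] := @fejer_limit x.
have NN : (N <= (4 * N.+1).-1)%N by rewrite mulSn addSn leq_addr.
have := hN _ NN.
rewrite ler_norml => /andP[_]; have := hc N; lra.
Qed.

Lemma fejer_lipschitz_bound L x : 0 <= L ->
  (forall s t, 0 < s < 1 -> 0 < t < 1 -> `|p s - p t| <= L * `|s - t|) ->
  rdot (D x) x <= 1 / 8 * L * ((phi x 0 + phi x 1) / 2 - phi x (1 / 2)).
Proof.
move=> L0 hL; apply: fejer_le => m.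
by apply: midmean_fejer_le_lipschitz => // s t l; exact: phi_convex.
Qed.

(** The slope of phi at 0, the end [B], is bounded below by - <LB x, x>, and that of t -> phi(1 -
    t), starting at [A], by <LA x, x>. *)
Lemma fejer_gateaux_bound LA LB x :
  is_gateaux I (cfc f) A (B - A) LA -> is_gateaux I (cfc f) B (B - A) LB ->
  rdot (D x) x <= 1 / 16 * (p (1 / 2) - p 0) * (rdot (LB x) x - rdot (LA x) x).
Proof.
move=> gA gB; apply: fejer_le => m.
have -> : rdot (LB x) x - rdot (LA x) x = - (-1 * rdot (LB x) x) - 1 * rdot (LA x) x by ring.
have cphi s t l := @phi_convex x s t l.
apply: midmean_fejer_le_slopes => //.
- apply: (gateaux_slope gB) => [|t t01|t t01|t l t01 l01].
  + by rewrite normrN normr1.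
  + by rewrite segment_from_B; exact: segment_SA.
  + by rewrite segment_from_B.
  + have z01 : 0 <= (0 : R) <= 1 by rewrite lexx ler01.
    by have := cphi _ _ _ z01 t01 l01; rewrite mulr0 add0r.
- have h := gateaux_slope (phi := fun t => phi x (1 - t)) gA (normr1 _).
  move=> t t01; have := h x _ _ _ t t01; rewrite subr0; apply.
  + move=> s s01; rewrite segment_from_A; apply: segment_SA; lra.
  + by move=> s s01; rewrite segment_from_A.
  + move=> s l s01 l01; have o01 : 0 <= (1 : R) <= 1 by rewrite lexx ler01.
    have s01' : 0 <= 1 - s <= 1 by lra.
    have := cphi _ _ _ o01 s01' l01.
    by rewrite (_ : (1 - l) * 1 + l * (1 - s) = 1 - l * s)//; ring.
Qed.

(** [op_leP] requires selfadjoint operators, whereas [is_gateaux] only provides bounded ones; the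
    steps that stay on the segment supply the symmetry. *)
Lemma gateaux_selfadjoint LA LB :
  is_gateaux I (cfc f) A (B - A) LA -> is_gateaux I (cfc f) B (B - A) LB ->
  selfadjoint (LB - LA).
Proof.
move=> gA gB.
have step d : 0 < d -> exists2 t : R, 0 < t <= 1 & t < d.
  move=> d0; exists (Num.min 1 (d / 2)).
    by rewrite lt_min ltr01 divr_gt0//= ge_min lexx.
  rewrite gt_min; apply/orP; right; rewrite ltr_pdivrMr// ltr_pMr// ltr1n//.
have z01 : 0 <= (0 : R) <= 1 by rewrite lexx ler01.
have o01 : 0 <= (1 : R) <= 1 by rewrite lexx ler01.
have sB : symop (cfc f B).
  by have /selfadjoint_symop := segment_selfadjoint z01; rewrite /F segment0.
have sA : symop (cfc f A).
  by have /selfadjoint_symop := segment_selfadjoint o01; rewrite /F segment1.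
apply: selfadjointB; apply/selfadjointP; split.
- by case: gB.
- apply: (gateaux_symop gB) => // d /step[t /andP[t0 t1] td].
  have t01 : 0 <= t <= 1 by rewrite ltW.
  exists (-1 * t); rewrite mulf_neq0 ?oppr_eq0 ?oner_eq0 ?gt_eqF//.
  rewrite mulN1r normrN gtr0_norm// -mulN1r segment_from_B; split=> //.
    exact: segment_SA.
  exact/selfadjoint_symop/segment_selfadjoint.
- by case: gA.
- apply: (gateaux_symop gA) => // d /step[t /andP[t0 t1] td].
  have t01 : 0 <= 1 - t <= 1 by lra.
  exists (1 * t); rewrite segment_from_A mul1r gt_eqF// gtr0_norm//; split=> //.
    exact: segment_SA.
  exact/selfadjoint_symop/segment_selfadjoint.
Qed.

End OperatorFejer.

Theorem theorem3 (R : realType) (I : interval R) (f p : R -> R)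
    (H : hilbertType R) (A B : H -> H)
    (hf : operator_convex I f) (hA : SA I A) (hB : SA I B)
    (psym : forall t : R, 0 <= t <= 1 -> p (1 - t) = p t)
    (pmono : forall s t : R, 0 <= s -> s <= t -> t <= 1 / 2 -> p s <= p t) :
  let D : H -> H :=
    (\int[lebesgue_measure]_(t in `[0, 1]) p t)%:C *:
      op_integral (fun t : R => cfc f (t%:C *: A + (1 - t)%:C *: B))
    - op_integral
        (fun t : R => (p t)%:C *: cfc f (t%:C *: A + (1 - t)%:C *: B)) in
  ((forall t : R, 0 < t < 1 -> derivable p t 1) ->
     op_le 0 D /\
     (has_ubound [set `|derive1 p t| | t in `]0, 1[ ] ->
      op_le D ((1 / 8 * supnorm01 (derive1 p))%:C *:
        ((1 / 2)%:C *: (cfc f A + cfc f B) - cfc f ((1 / 2)%:C *: (A + B))))))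
  /\
  (gateaux_on I (cfc f) (segment A B) ->
     op_le 0 D /\
     op_le D ((1 / 16 * (p (1 / 2) - p 0))%:C *:
       (nabla I (cfc f) B (B - A) - nabla I (cfc f) A (B - A)))).
Proof.
move=> D; have [Hn|Hn] := pselect (exists x : H, x != 0); last first.
  by split=> _; split=> *; exact: op_le_trivial.
have sD : selfadjoint D := fejer_selfadjoint hf hA hB psym pmono Hn.
have D0 : op_le 0 D.
  apply/(op_leP (@selfadjoint0 _ _) sD) => x.
  rewrite -[(0 : H -> H) x]/(0 : H) rdot0l.
  exact: (fejer_ge0 hf hA hB psym pmono Hn x).
have sF := segment_selfadjoint hf hA hB Hn.
have z01 : 0 <= (0 : R) <= 1 by rewrite lexx ler01.
have o01 : 0 <= (1 : R) <= 1 by rewrite lexx ler01.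
have h01 : 0 <= (1 / 2 : R) <= 1 by lra.
split=> [dp|gat]; split=> //.
- move=> ub; set L := supnorm01 _.
  have hL t : 0 < t < 1 -> `|derive1 p t| <= L.
    by move=> t01; apply: ub_le_sup => //; exists t; rewrite //= in_itv.
  have L0 : 0 <= L by apply: le_trans (hL (1 / 2) _); [exact: normr_ge0|lra].
  have := sF _ z01; rewrite segment0 => sB; have := sF _ o01; rewrite segment1 => sA.
  have := sF _ h01; rewrite segment_half => sh.
  apply/op_leP => //.
    apply: selfadjointZ; apply: selfadjointB => //; apply: selfadjointZ.
    exact: selfadjointD.
  move=> x; have lip := derive_lipschitz dp hL.
  have := fejer_lipschitz_bound hf hA hB psym pmono Hn x L0 lip.
  rewrite segment0 segment1 segment_half => /le_trans; apply.
  rewrite -[X in _ <= rdot X x]/((1 / 8 * L)%:C *: ((1 / 2)%:C *: (cfc f A x + cfc f B x)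
    - cfc f ((1 / 2)%:C *: (A + B)) x)).
  rewrite rdotZl rdotBl rdotZl rdotDl le_eqVlt; apply/orP; left; apply/eqP.
  by ring.
have bBA : bounded_op (B - A).
  by apply: bopB; apply: selfadjoint_bop; [case: hB|case: hA].
(* [nabla] is a choice, so its property comes from the assumed existence at the end points of the
   segment, with parameters 0 and 1. *)
have gA : is_gateaux I (cfc f) A (B - A) (nabla I (cfc f) A (B - A)).
  apply: getPex; apply: gat => //; exists 0 => /=; first by rewrite in_itv.
  by rewrite subr0 scale1r scale0r addr0.
have gB : is_gateaux I (cfc f) B (B - A) (nabla I (cfc f) B (B - A)).
  apply: getPex; apply: gat => //; exists 1 => /=; first by rewrite in_itv.
  by rewrite subrr scale0r scale1r add0r.
apply/op_leP => //.
  by apply: selfadjointZ; exact: (gateaux_selfadjoint hf hA hB Hn gA gB).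
move=> x; have := fejer_gateaux_bound hf hA hB psym pmono Hn x gA gB.
by rewrite -rdotBl -rdotZl.
Qed.
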